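(* Let $d\ge1$ and $p\ge2$ be integers, let $\omega\in\mathbb{R}^d$ have nonzero components, let $s\ge0$, and put $\|\omega\|^2=\sum_{1\le i\le d}\omega_i^2$. Consider $i u_t=\triangle u+u^p$ on $\mathbb{T}^d$ with initial data $u(0)=u_0\in A_s^+(\mathbb{T}^d)$ supported on strictly positive Fourier modes, that is, $\hat u_0(n)\ne0$ only if $n_i\ge1$ for all $1\le i\le d$. If $$\|u_0\|\le\frac{p-1}{p}\left(\frac{\|\omega\|^2(p-1)}{2}\right)^{1/(p-1)},$$ then the solution $u\in C^0(\mathbb{R},A_s^+(\mathbb{T}^d))$ is (quasi)periodic with frequencies $\{\omega_i^2/2\pi\}_{i=1}^d$, and $$\|u(t)\|\le\left(\frac{\|\omega\|^2(p-1)}{2}\right)^{1/(p-1)}\qquad\text{for all }t\in\mathbb{R}.$$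
   Context: $\mathbb{T}^d=\prod_{i=1}^d\mathbb{R}/\frac{2\pi}{\omega_i}\mathbb{Z}$. For $n\in\mathbb{Z}^d$: $|n|=|n_1|+\dots+|n_d|$, $\omega nx=\sum_k\omega_kn_kx_k$, $\omega^2n^2=\sum_k\omega_k^2n_k^2$. For $u\in L^1(\mathbb{T}^d)$, $\hat u(n)=\frac{1}{\mathrm{vol}(\mathbb{T}^d)}\int_{\mathbb{T}^d}u(x)e^{-i\omega nx}dx$ and $\|u\|=\sum_{n\in\mathbb{Z}^d}(1+|n|)^s|\hat u(n)|$. The weighted Wiener algebra is $A_s(\mathbb{T}^d)=\{u\in L^1(\mathbb{T}^d):\|u\|<\infty\}$, and $A_s^+(\mathbb{T}^d)=\{u\in A_s(\mathbb{T}^d):\hat u(n)\ne0\text{ only if }\min_in_i\ge0\}$. The PDE is locally well-posed on $A_s(\mathbb{T}^d)$; a solution is a function continuous in time with values in $A_s(\mathbb{T}^d)$ satisfying Duhamel's formula $\widehat{u(t)}(n)=e^{i\omega^2n^2t}\hat u_0(n)-i\int_0^te^{i\omega^2n^2(t-\tau)}\widehat{u(\tau)^p}(n)\,d\tau$ for all $n$. The conclusion includes that the solution is defined for all $t\in\mathbb{R}$. ''(Quasi)periodic with frequencies $\{\omega_i^2/2\pi\}_{i=1}^d$'' means there is a continuous map $F:(\mathbb{R}/2\pi\mathbb{Z})^d\to A_s^+(\mathbb{T}^d)$ with $u(t)=F(\omega_1^2t,\dots,\omega_d^2t)$ for all $t\in\mathbb{R}$ (no rational independence of the $\omega_i^2$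 is required, so periodic functions are included). *)

(* Defs.v *)
From HB Require Import structures.
From mathcomp Require Import all_boot all_order all_algebra.
From mathcomp Require Import all_classical all_reals all_analysis.
From mathcomp Require Import complex.
Set Implicit Arguments.
Unset Strict Implicit.
Unset Printing Implicit Defensive.
Import Order.TTheory GRing.Theory Num.Theory.
Import numFieldNormedType.Exports.
Local Open Scope classical_set_scope.
Local Open Scope ring_scope.
Local Open Scope complex_scope.

Section lebesgue_tuple.
Variable R : realType.

Definition tuple_cons n (z : measurableTypeR R * n.-tuple (measurableTypeR R)) :
    n.+1.-tuple (measurableTypeR R) :=
  [tuple of z.1 :: z.2].

Lemma measurable_tuple_cons n : measurable_fun setT (@tuple_cons n).
Proof. exact: measurable_cons measurable_fst measurable_snd. Qed.

Section step.
Variables (n : nat)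
  (mu : {measure set (n.-tuple (measurableTypeR R)) -> \bar R}).

Definition lebesgue_cons : set (n.+1.-tuple (measurableTypeR R)) -> \bar R :=
  pushforward (lebesgue_measure \x^ mu)%E (@tuple_cons n).

HB.instance Definition _ := Measure.copy lebesgue_cons
  (measure_function_pushforward__canonical__measure_function_Measure
     (lebesgue_measure \x^ mu)%E (@measurable_tuple_cons n)).
End step.

(* d-dimensional Lebesgue measure on the Borel sets of R^d. *)
Fixpoint lebesgue_tuple d :
    {measure set (d.-tuple (measurableTypeR R)) -> \bar R} :=
  match d with
  | 0 => dirac [tuple]
  | d'.+1 => lebesgue_cons (lebesgue_tuple d')
  end.

Lemma lebesgue_tuple_box d (I : 'I_d -> set (measurableTypeR R)) :
  (forall i, measurable (I i)) ->
  lebesgue_tuple d [set x | forall i, I i (tnth x i)] =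
  (\prod_(i < d) lebesgue_measure (I i))%E.
Proof.
elim: d I => [|d IH] I mI.
  by rewrite big_ord0 /= diracE mem_set// => -[].
have mB d' (J : 'I_d' -> set (measurableTypeR R)) : (forall i, measurable (J i)) ->
  measurable [set x : d'.-tuple (measurableTypeR R) | forall i, J i (tnth x i)].
  move=> mJ; rewrite (_ : [set _ | _] = \bigcap_(i in [set: 'I_d']) ((@tnth _ _ ^~ i) @^-1` J i)).
    apply: fin_bigcap_measurable => // i _; rewrite -[X in measurable X]setTI.
    exact: measurable_tnth.
  by apply/seteqP; split => x /= h; [move=> i _; exact: h|move=> i; exact: (h i)].
rewrite big_ord_recl -IH//=.
rewrite -product_measure2E//.
rewrite /lebesgue_cons /pushforward; congr (_ _).
apply/seteqP; split => -[a x] /=.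
  move=> h; split; first exact: (h ord0).
  by move=> i; move: (h (lift ord0 i)); rewrite tnthS.
by move=> [h0 h] i; case: (unliftP ord0 i) => [j ->|->//]; rewrite tnthS.
exact: (mB _ _ (fun i => mI _)).
Qed.

End lebesgue_tuple.

Section complex_integral.
Context {disp : measure_display} {T : measurableType disp} {R : realType}.
Variable mu : {measure set T -> \bar R}.

Definition cintegrable (D : set T) (f : T -> R[i]) : Prop :=
  mu.-integrable D (fun x => (complex.Re (f x))%:E) /\
  mu.-integrable D (fun x => (complex.Im (f x))%:E).

Definition cintegral (D : set T) (f : T -> R[i]) : R[i] :=
  (\int[mu]_(x in D) complex.Re (f x)) +i* (\int[mu]_(x in D) complex.Im (f x)).

End complex_integral.

Section torus.
Variable R : realType.

Definition oriented_cintegral (a b : R) (f : R -> R[i]) : R[i] :=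
  if a <= b then cintegral lebesgue_measure `[a, b]%classic f
  else - cintegral lebesgue_measure `[b, a]%classic f.

Definition cis (a : R) : R[i] := cos a +i* sin a.

Variables (d : nat) (w : 'rV[R]_d).

(* A function on the torus is a function on R^d that is 2 pi / w_i periodic in
   its i-th variable.  Points of R^d are tuples because tuples carry the product
   sigma-algebra. *)
Definition periodic (u : d.-tuple R -> R[i]) : Prop :=
  forall (m : 'rV[int]_d) (x : d.-tuple R),
    u [tuple tnth x i + 2 * pi / w ord0 i * (m ord0 i)%:~R | i < d] = u x.

(* A fundamental domain; the components of w may be negative. *)
Definition cell : set (d.-tuple R) :=
  [set x | forall i, 0 <= tnth x i < 2 * pi / `|w ord0 i|].

(* Elements of L^1 are represented by functions, compared with torus_aeq. *)
Definition torus_L1 (u : d.-tuple R -> R[i]) : Prop :=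
  periodic u /\ cintegrable (lebesgue_tuple R d) cell u.

Definition torus_aeq (u v : d.-tuple R -> R[i]) : Prop :=
  u = v %[ae (lebesgue_tuple R d) in cell].

Definition phase (n : 'rV[int]_d) (x : d.-tuple R) : R :=
  \sum_(k < d) w ord0 k * (n ord0 k)%:~R * tnth x k.

Definition dispersion (n : 'rV[int]_d) : R :=
  \sum_(k < d) w ord0 k ^+ 2 * (n ord0 k)%:~R ^+ 2.

Definition fourier (u : d.-tuple R -> R[i]) (n : 'rV[int]_d) : R[i] :=
  ((fine (lebesgue_tuple R d cell))^-1)%:C *
  cintegral (lebesgue_tuple R d) cell (fun x => u x * cis (- phase n x)).

Definition norm1 (n : 'rV[int]_d) : nat := (\sum_(k < d) `|n ord0 k|)%N.

Variable s : R.

Definition wnorm (u : d.-tuple R -> R[i]) : \bar R :=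
  (\esum_(n in [set: 'rV[int]_d])
     ((1 + (norm1 n)%:R) `^ s * ComplexField.Normc.normc (fourier u n))%:E)%E.

Definition wiener (u : d.-tuple R -> R[i]) : Prop :=
  torus_L1 u /\ (wnorm u < +oo)%E.

Definition wiener_plus (u : d.-tuple R -> R[i]) : Prop :=
  wiener u /\ forall n, fourier u n != 0 -> forall i, 0 <= n ord0 i.

(* f is continuous on D for the distance wnorm (f y - f x). *)
Definition wcontinuous (T : topologicalType) (D : set T)
    (f : T -> d.-tuple R -> R[i]) : Prop :=
  forall x, D x ->
    wnorm (fun z => f y z - f x z) @[y --> within D (nbhs x)] --> 0%E.

Definition solution (p : nat) (J : set R) (u0 : d.-tuple R -> R[i])
    (u : R -> d.-tuple R -> R[i]) : Prop :=
  [/\ forall t, J t -> wiener (u t),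
      wcontinuous J u &
      forall t n, J t ->
        fourier (u t) n = cis (dispersion n * t) * fourier u0 n
          - 'i%C * oriented_cintegral 0 t (fun tau =>
              cis (dispersion n * (t - tau))
              * fourier (fun x => u tau x ^+ p) n)].

(* A continuous map on (R / 2 pi Z)^d is a continuous map on R^d that is
   2 pi periodic in each variable. *)
Definition quasiperiodic (u : R -> d.-tuple R -> R[i]) : Prop :=
  exists F : 'rV[R]_d -> d.-tuple R -> R[i],
    [/\ forall th, wiener_plus (F th),
        forall (m : 'rV[int]_d) th,
          torus_aeq (F (th + \row_i (2 * pi * (m ord0 i)%:~R))) (F th),
        wcontinuous setT F &
        forall t, torus_aeq (u t) (F (\row_i (w ord0 i ^+ 2 * t)))].

End torus.

(* Main.v *)
Require Import Defs.
From HB Require Import structures.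
From mathcomp Require Import all_boot all_order all_algebra.
From mathcomp Require Import all_classical all_reals all_analysis.
From mathcomp Require Import complex measurable_realfun zify ring lra.
Set Implicit Arguments.
Unset Strict Implicit.
Unset Printing Implicit Defensive.
Import Order.TTheory GRing.Theory Num.Theory.
Import numFieldNormedType.Exports.
Local Open Scope classical_set_scope.
Local Open Scope ring_scope.
Local Open Scope complex_scope.

(* Look for u(t) = F(w_1^2 t, ..., w_d^2 t), where every Fourier coefficient of
   F(th) is a finite sum of exponentials c e^(i k.th).  On strictly positive
   modes Duhamel's formula is triangular: mode n of u^p involves only modes
   smaller than n, so the exponential sums are built by recursion on |n|.  If
   n = n_1 + ... + n_p with positive n_j, then
   w^2 n^2 - sum_j w^2 n_j^2 >= p (p - 1) |w|^2, so no small divisor occurs and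
   integrating in time costs at most 2 / (p (p - 1) |w|^2) in the weighted l^1
   norm over all modes and frequencies.  With this constant the ball of radius
   (|w|^2 (p - 1) / 2)^(1 / (p - 1)) is stable under the recursion.

   Any other solution agrees with u by iterating the Lipschitz bound for
   v |-> v^p in the Wiener algebra (Gronwall), which identifies the Fourier
   coefficients only.  To pass to functions, an integrable f whose coefficients
   all vanish is shown to be null: the bounded g such that f g inherits this
   property for every such f are closed under products and bounded limits and
   contain the trigonometric functions, hence the indicator functions of all
   Borel sets of a period cell. *)

(** Origin of the gap: in each coordinate the difference n_i^2 - sum_j n_{j,i}^2 is the sum of the
    cross terms n_{j,i} n_{k,i} over ordered pairs j <> k, each at least 1 on strictly positive
    modes. So only an upper bound on the frequencies present in mode n has to be propagated. The 2
    in the cost: each forcing exponential leaves its own response and a free wave that restores the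
    value at t = 0. Frequencies are kept as integer vectors k, because the w_i^2 may be rationally
    dependent while F must be a function of d independent angles. Terms with equal k stay separate,
    so the l^1 norm is exactly multiplicative on products. The radius rho splits as (p-1)/p rho for
    the datum and rho/p for the forcing: with rho^(p-1) = |w|^2 (p-1)/2, the forced part 2 rho^p /
    (p (p-1) |w|^2) is exactly rho/p. Elements of the Wiener algebra are known only up to null sets,
    so even the integrability of u^p rests on u agreeing almost everywhere with its bounded Fourier
    series. *)

Local Notation Re := complex.Re.
Local Notation Im := complex.Im.
Local Notation normc := ComplexField.Normc.normc.

(** * Complex numbers and complex integration *)

Section complex_numbers.
Variable R : realType.
Implicit Types z y : R[i].

Lemma cReD z y : Re (z + y) = Re z + Re y. Proof. by case: z; case: y. Qed.
Lemma cImD z y : Im (z + y) = Im z + Im y. Proof. by case: z; case: y. Qed.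
Lemma cReN z : Re (- z) = - Re z. Proof. by case: z. Qed.
Lemma cImN z : Im (- z) = - Im z. Proof. by case: z. Qed.
Lemma cReM z y : Re (z * y) = Re z * Re y - Im z * Im y.
Proof. by case: z; case: y. Qed.
Lemma cImM z y : Im (z * y) = Re z * Im y + Im z * Re y.
Proof. by case: z; case: y. Qed.

Lemma cRe_sum I (r : seq I) (F : I -> R[i]) :
  Re (\sum_(i <- r) F i) = \sum_(i <- r) Re (F i).
Proof. exact: (big_morph _ cReD). Qed.
Lemma cIm_sum I (r : seq I) (F : I -> R[i]) :
  Im (\sum_(i <- r) F i) = \sum_(i <- r) Im (F i).
Proof. exact: (big_morph _ cImD). Qed.

Lemma eq_ReIm z y : Re z = Re y -> Im z = Im y -> z = y.
Proof. by case: z; case: y => a b c d /= -> ->. Qed.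

Lemma normc_ge0 z : 0 <= normc z.
Proof. by case: z => a b; exact: sqrtr_ge0. Qed.

Lemma normc_ge_absRe z : `|Re z| <= normc z.
Proof.
case: z => a b /=; rewrite -sqrtr_sqr ler_wsqrtr//.
by rewrite lerDl sqr_ge0.
Qed.

Lemma normc_ge_absIm z : `|Im z| <= normc z.
Proof.
case: z => a b /=; rewrite -sqrtr_sqr ler_wsqrtr//.
by rewrite lerDr sqr_ge0.
Qed.

Lemma normc_le_ReIm z : normc z <= `|Re z| + `|Im z|.
Proof.
case: z => a b /=.
rewrite -(ger0_norm (addr_ge0 (normr_ge0 a) (normr_ge0 b))) -sqrtr_sqr.
rewrite ler_wsqrtr// sqrrD !real_normK ?num_real//.
by rewrite -addrA lerD2l lerDr mulrn_wge0 ?mulr_ge0.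
Qed.

Lemma normcD_le z y : normc (z + y) <= normc z + normc y.
Proof. exact: (@le_normcD R z y). Qed.

Lemma normc_opp z : normc (- z) = normc z.
Proof. by case: z => a b /=; rewrite !sqrrN. Qed.

Lemma normc_distC z y : normc (z - y) = normc (y - z).
Proof. by rewrite -normc_opp opprB. Qed.

Lemma normc_sum I (r : seq I) (F : I -> R[i]) :
  normc (\sum_(i <- r) F i) <= \sum_(i <- r) normc (F i).
Proof.
elim: r => [|i r IH]; first by rewrite !big_nil ComplexField.Normc.normc0.
by rewrite !big_cons (le_trans (normcD_le _ _))// lerD2l.
Qed.

Lemma normc_prod_le1 I (r : seq I) (F : I -> R[i]) :
  (forall i, normc (F i) <= 1) -> normc (\prod_(i <- r) F i) <= 1.
Proof.
move=> F1; elim/big_ind: _ => //; first by rewrite ComplexField.Normc.normc1.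
by move=> x y x1 y1; rewrite ComplexField.Normc.normcM mulr_ile1 ?normc_ge0.
Qed.

Lemma normc_real (a : R) : normc a%:C = `|a|.
Proof. by rewrite /= expr0n/= addr0 sqrtr_sqr. Qed.

Lemma cisD (a b : R) : cis (a + b) = cis a * cis b.
Proof.
apply: eq_ReIm; rewrite ?cReM ?cImM /= ?cosD ?sinD//.
by rewrite addrC (mulrC (cos a)); congr (_ + _); rewrite mulrC.
Qed.

Lemma cis0 : cis (0 : R) = 1.
Proof. by rewrite /cis cos0 sin0. Qed.

Lemma normc_cis (a : R) : normc (cis a) = 1.
Proof. by rewrite /= cos2Dsin2 sqrtr1. Qed.

Lemma cisN_mul (a : R) : cis a * cis (- a) = 1.
Proof. by rewrite -cisD subrr cis0. Qed.

Lemma cis_sum I (r : seq I) (F : I -> R) :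
  cis (\sum_(i <- r) F i) = \prod_(i <- r) cis (F i).
Proof. exact: (big_morph _ cisD cis0). Qed.

Lemma cis_2pi_nat (n : nat) : cis (2 * pi * n%:R : R) = 1.
Proof.
elim: n => [|n IH]; first by rewrite mulr0 cis0.
have cispi : cis (pi : R) = -1 by rewrite /cis cospi sinpi; apply: eq_ReIm => /=; rewrite ?oppr0.
rewrite -(natr1 n) mulrDr mulr1 cisD IH mul1r mulr_natl mulr2n cisD cispi.
by rewrite mulrNN mulr1.
Qed.

Lemma cis_2pi_int (m : int) : cis (2 * pi * m%:~R : R) = 1.
Proof.
case: m => n; first exact: cis_2pi_nat.
have := cisN_mul (2 * pi * n.+1%:R : R); rewrite cis_2pi_nat mul1r.
by rewrite NegzE mulrNz mulrN.
Qed.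

End complex_numbers.

Section complex_limits.
Variable R : realType.

Lemma cvg_sum_seq (T : Type) (F : set_system T) (FF : Filter F) I (r : seq I)
    (f : I -> T -> R) (l : I -> R) : (forall i, f i x @[x --> F] --> l i) ->
  \sum_(i <- r) f i x @[x --> F] --> \sum_(i <- r) l i.
Proof.
move=> fl; elim: r => [|i r IH].
  by under eq_fun do rewrite big_nil; rewrite big_nil; exact: cvg_cst.
by under eq_fun do rewrite big_cons; rewrite big_cons; apply: cvgD.
Qed.

Definition ccvg (T : Type) (F : set_system T) (f : T -> R[i]) (l : R[i]) : Prop :=
  (Re (f x) @[x --> F] --> Re l) /\ (Im (f x) @[x --> F] --> Im l).

Variables (T : Type) (F : set_system T).
Context {FF : Filter F}.

Lemma ccvg_cst z : ccvg F (fun=> z) z.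
Proof. by split; exact: cvg_cst. Qed.

Lemma ccvgD f g y z : ccvg F f y -> ccvg F g z -> ccvg F (fun x => f x + g x) (y + z).
Proof.
move=> [fr fi] [gr gi]; split.
- under eq_cvg do rewrite cReD; rewrite cReD; exact: cvgD.
- under eq_cvg do rewrite cImD; rewrite cImD; exact: cvgD.
Qed.

Lemma ccvgM f g y z : ccvg F f y -> ccvg F g z -> ccvg F (fun x => f x * g x) (y * z).
Proof.
move=> [fr fi] [gr gi]; split.
- by under eq_cvg do rewrite cReM; rewrite cReM; apply: cvgB; exact: cvgM.
- by under eq_cvg do rewrite cImM; rewrite cImM; apply: cvgD; exact: cvgM.
Qed.

Lemma ccvg_sum I (r : seq I) f y : (forall i, ccvg F (f i) (y i)) ->
  ccvg F (fun x => \sum_(i <- r) f i x) (\sum_(i <- r) y i).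
Proof.
move=> fy; elim: r => [|i r IH].
  by under eq_fun do rewrite big_nil; rewrite big_nil; exact: ccvg_cst.
by under eq_fun do rewrite big_cons; rewrite big_cons; exact: ccvgD.
Qed.

Lemma ccvg_normcP f y : ccvg F f y <-> (normc (f x - y) @[x --> F] --> 0).
Proof.
split=> [[fr fi]|fy].
- have h : `|Re (f x) - Re y| + `|Im (f x) - Im y| @[x --> F] --> 0.
    rewrite -[X in _ --> X]addr0; apply: cvgD.
    + by rewrite -(normr0 R) -(subrr (Re y)); apply: cvg_norm; apply: cvgB => //; exact: cvg_cst.
    + by rewrite -(normr0 R) -(subrr (Im y)); apply: cvg_norm; apply: cvgB => //; exact: cvg_cst.
  apply: (squeeze_cvgr _ (cvg_cst 0) h); apply: nearW => x.
  by rewrite normc_ge0/= (le_trans (normc_le_ReIm _))// cReD cReN cImD cImN.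
- split.
  + apply/subr_cvg0/norm_cvg0P; apply: (squeeze_cvgr _ (cvg_cst 0) fy).
    by apply: nearW => x; rewrite normr_ge0/= -cReN -cReD normc_ge_absRe.
  + apply/subr_cvg0/norm_cvg0P; apply: (squeeze_cvgr _ (cvg_cst 0) fy).
    by apply: nearW => x; rewrite normr_ge0/= -cImN -cImD normc_ge_absIm.
Qed.

Lemma ccvg_normc f y : ccvg F f y -> normc (f x) @[x --> F] --> normc y.
Proof.
move=> /ccvg_normcP fy; apply/subr_cvg0/norm_cvg0P.
apply: (squeeze_cvgr _ (cvg_cst 0) fy); apply: nearW => x; rewrite normr_ge0/=.
have h1 := normcD_le (f x - y) y; have h2 := normcD_le (y - f x) (f x).
rewrite !subrK in h1 h2; rewrite (normc_distC y) in h2.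
by rewrite ler_norml; lra.
Qed.

End complex_limits.

Lemma ccvg_unique (R : realType) (T : Type) (F : set_system T) {FF : ProperFilter F}
    (f : T -> R[i]) y z : ccvg F f y -> ccvg F f z -> y = z.
Proof.
move=> [fr fi] [gr gi]; apply: eq_ReIm.
- exact: cvg_unique fr gr.
- exact: cvg_unique fi gi.
Qed.


Section complex_measurable.
Context {disp : measure_display} {T : measurableType disp} {R : realType}.
Variable D : set T.
Implicit Types f g : T -> R[i].

Definition cmeasurable f : Prop :=
  measurable_fun D (fun x => Re (f x)) /\ measurable_fun D (fun x => Im (f x)).

Lemma cmeasurable_cst z : cmeasurable (fun=> z).
Proof. by split; exact: measurable_cst. Qed.

Lemma cmeasurableD f g : cmeasurable f -> cmeasurable g ->
  cmeasurable (fun x => f x + g x).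
Proof.
move=> [fr fi] [gr gi]; split.
- by under eq_fun do rewrite cReD; exact: measurable_funD.
- by under eq_fun do rewrite cImD; exact: measurable_funD.
Qed.

Lemma cmeasurableM f g : cmeasurable f -> cmeasurable g ->
  cmeasurable (fun x => f x * g x).
Proof.
move=> [fr fi] [gr gi]; split.
- by under eq_fun do rewrite cReM; apply: measurable_funB; exact: measurable_funM.
- by under eq_fun do rewrite cImM; apply: measurable_funD; exact: measurable_funM.
Qed.

Lemma cmeasurable_sum I (r : seq I) (f : I -> T -> R[i]) :
  (forall i, cmeasurable (f i)) -> cmeasurable (fun x => \sum_(i <- r) f i x).
Proof.
move=> mf; elim: r => [|i r IH].
  by under eq_fun do rewrite big_nil; exact: cmeasurable_cst.
by under eq_fun do rewrite big_cons; exact: cmeasurableD.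
Qed.

Lemma cmeasurable_prod I (r : seq I) (f : I -> T -> R[i]) :
  (forall i, cmeasurable (f i)) -> cmeasurable (fun x => \prod_(i <- r) f i x).
Proof.
move=> mf; elim: r => [|i r IH].
  by under eq_fun do rewrite big_nil; exact: cmeasurable_cst.
by under eq_fun do rewrite big_cons; exact: cmeasurableM.
Qed.

Lemma cmeasurable_ccvg (f_ : nat -> T -> R[i]) f :
  (forall n, cmeasurable (f_ n)) ->
  (forall x, D x -> ccvg \oo (f_^~ x) (f x)) -> cmeasurable f.
Proof.
move=> mf ff; split.
- apply: (@measurable_fun_cvg _ _ _ _ (fun n x => Re (f_ n x))).
    by move=> n; exact: (mf n).1.
  by move=> x /ff[].
- apply: (@measurable_fun_cvg _ _ _ _ (fun n x => Im (f_ n x))).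
    by move=> n; exact: (mf n).2.
  by move=> x /ff[].
Qed.

End complex_measurable.

Lemma le_bounded (R : realType) (T : Type) (D : set T) (f : T -> R) (M : R) :
  (forall x, D x -> `|f x| <= M) -> [bounded f x | x in D].
Proof.
move=> fM; exists M; split; first exact: num_real.
by move=> N MN x Dx; exact: le_trans (fM x Dx) (ltW MN).
Qed.

Section complex_integration.
Context {disp : measure_display} {T : measurableType disp} {R : realType}.
Variable mu : {measure set T -> \bar R}.
Variable D : set T.
Hypothesis mD : measurable D.
Implicit Types f g : T -> R[i].

Lemma cintegrable_measurable f : cintegrable mu D f -> cmeasurable D f.
Proof.
move=> [fr fi]; split.
- exact/measurable_EFinP/(measurable_int mu fr).
- exact/measurable_EFinP/(measurable_int mu fi).
Qed.

Lemma cintegrableD f g : cintegrable mu D f -> cintegrable mu D g ->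
  cintegrable mu D (fun x => f x + g x).
Proof.
move=> [fr fi] [gr gi]; split.
- under eq_fun do rewrite cReD EFinD; exact: integrableD.
- under eq_fun do rewrite cImD EFinD; exact: integrableD.
Qed.

Lemma cintegralD f g : cintegrable mu D f -> cintegrable mu D g ->
  cintegral mu D (fun x => f x + g x) = cintegral mu D f + cintegral mu D g.
Proof.
move=> [fr fi] [gr gi]; apply: eq_ReIm; rewrite ?cReD ?cImD /=.
- by under eq_Rintegral do rewrite cReD; exact: RintegralD.
- by under eq_Rintegral do rewrite cImD; exact: RintegralD.
Qed.

Lemma cintegrableM_bounded f g M : cintegrable mu D f -> cmeasurable D g ->
  (forall x, D x -> normc (g x) <= M) -> cintegrable mu D (fun x => f x * g x).
Proof.
move=> [fr fi] [gr gi] gM.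
have gRe : [bounded Re (g x) | x in D].
  by apply: le_bounded => x Dx; exact: le_trans (normc_ge_absRe _) (gM _ Dx).
have gIm : [bounded Im (g x) | x in D].
  by apply: le_bounded => x Dx; exact: le_trans (normc_ge_absIm _) (gM _ Dx).
split.
- under eq_fun do rewrite cReM EFinB !EFinM.
  by apply: integrableB => //; exact: integrableMl.
- under eq_fun do rewrite cImM EFinD !EFinM.
  by apply: integrableD => //; exact: integrableMl.
Qed.

Lemma cintegrableZ z f : cintegrable mu D f -> cintegrable mu D (fun x => z * f x).
Proof.
move=> cf; under eq_fun do rewrite mulrC.
by apply: (@cintegrableM_bounded _ _ (normc z)) => //; exact: cmeasurable_cst.
Qed.

Lemma cintegralZ z f : cintegrable mu D f ->
  cintegral mu D (fun x => z * f x) = z * cintegral mu D f.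
Proof.
move=> [fr fi]; have Z (r : R) (h : T -> R) : mu.-integrable D (EFin \o h) ->
    mu.-integrable D (EFin \o (fun x => r * h x)).
  move=> ih; have := integrableZl mD r ih; apply: eq_integrable => // x _.
apply: eq_ReIm; rewrite ?cReM ?cImM /=.
- under eq_Rintegral do rewrite cReM.
  by rewrite RintegralB ?RintegralZl//; exact: Z.
- under eq_Rintegral do rewrite cImM.
  by rewrite RintegralD ?RintegralZl//; exact: Z.
Qed.

Lemma cintegrableN f : cintegrable mu D f -> cintegrable mu D (fun x => - f x).
Proof. by move=> /(cintegrableZ (-1)); under eq_fun do rewrite mulN1r. Qed.

Lemma cintegralN f : cintegrable mu D f ->
  cintegral mu D (fun x => - f x) = - cintegral mu D f.
Proof.
move=> cf; rewrite -mulN1r -cintegralZ//; congr (cintegral _ _ _).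
by apply/funext => x; rewrite mulN1r.
Qed.

Lemma cintegrableB f g : cintegrable mu D f -> cintegrable mu D g ->
  cintegrable mu D (fun x => f x - g x).
Proof. by move=> cf /cintegrableN; exact: cintegrableD. Qed.

Lemma cintegralB f g : cintegrable mu D f -> cintegrable mu D g ->
  cintegral mu D (fun x => f x - g x) = cintegral mu D f - cintegral mu D g.
Proof. by move=> cf cg; rewrite cintegralD ?cintegralN//; exact: cintegrableN. Qed.

Lemma cintegral0 : cintegral mu D (fun=> 0) = 0.
Proof. by apply: eq_ReIm; rewrite /= Rintegral_cst// mul0r. Qed.

Lemma cintegrable0 : cintegrable mu D (fun=> 0).
Proof. by split; exact: integrable0. Qed.

Lemma cintegrable_sum I (r : seq I) (f : I -> T -> R[i]) :
  (forall i, cintegrable mu D (f i)) -> cintegrable mu D (fun x => \sum_(i <- r) f i x).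
Proof.
move=> cf; elim: r => [|i r IH].
  by under eq_fun do rewrite big_nil; exact: cintegrable0.
by under eq_fun do rewrite big_cons; exact: cintegrableD.
Qed.

Lemma cintegral_sum I (r : seq I) (f : I -> T -> R[i]) :
  (forall i, cintegrable mu D (f i)) ->
  cintegral mu D (fun x => \sum_(i <- r) f i x) = \sum_(i <- r) cintegral mu D (f i).
Proof.
move=> cf; elim: r => [|i r IH].
  by under eq_fun do rewrite big_nil; rewrite big_nil cintegral0.
under eq_fun do rewrite big_cons.
by rewrite big_cons cintegralD ?IH//; exact: cintegrable_sum.
Qed.

Lemma eq_cintegral f g : (forall x, D x -> f x = g x) ->
  cintegral mu D f = cintegral mu D g.
Proof.
by move=> fg; apply: eq_ReIm; apply: eq_Rintegral => x /set_mem /fg ->.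
Qed.

Lemma eq_cintegrable f g : (forall x, D x -> f x = g x) ->
  cintegrable mu D f -> cintegrable mu D g.
Proof.
by move=> fg [fr fi]; split; [move: fr|move: fi]; apply: eq_integrable => // x;
  rewrite inE => /fg ->.
Qed.

Lemma ae_eq_cintegral f g : cmeasurable D f -> cmeasurable D g ->
  f = g %[ae mu in D] -> cintegral mu D f = cintegral mu D g.
Proof.
move=> [fr fi] [gr gi] fg; apply: eq_ReIm; congr fine; apply: ae_eq_integral => //.
- exact/measurable_EFinP.
- exact/measurable_EFinP.
- by apply: filterS fg => x + Dx => ->.
- exact/measurable_EFinP.
- exact/measurable_EFinP.
- by apply: filterS fg => x + Dx => ->.
Qed.

Lemma ae_eq_cintegrable f g : cmeasurable D f -> f = g %[ae mu in D] ->
  cintegrable mu D g -> cintegrable mu D f.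
Proof.
move=> [fr fi] fg [gr gi].
have key (a b : T -> R) : measurable_fun D a -> a = b %[ae mu in D] ->
    mu.-integrable D (EFin \o b) -> mu.-integrable D (EFin \o a).
  move=> ma ab /integrableP[mb bfin]; apply/integrableP; split; first exact/measurable_EFinP.
  rewrite (@ae_eq_integral _ _ _ _ _ (abse \o (EFin \o b)))//.
  - by apply: measurableT_comp => //; exact/measurable_EFinP.
  - exact: measurableT_comp.
  - by apply: filterS ab => x + Dx => /(_ Dx) /= ->.
split; [apply: (key _ (fun x => Re (g x)))|apply: (key _ (fun x => Im (g x)))] => //.
- by apply: filterS fg => x + Dx => /(_ Dx) ->.
- by apply: filterS fg => x + Dx => /(_ Dx) ->.
Qed.

Lemma cintegrable_bounded f M : (mu D < +oo)%E -> cmeasurable D f ->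
  (forall x, D x -> normc (f x) <= M) -> cintegrable mu D f.
Proof.
move=> muD mf fM.
have c1 : cintegrable mu D (fun=> 1).
  split=> /=; last exact: integrable0.
  apply: measurable_bounded_integrable => //.
  by apply: (@le_bounded _ _ _ _ 1) => x _; rewrite normr1.
have := cintegrableM_bounded c1 mf fM.
by under eq_fun do rewrite mul1r.
Qed.

Lemma cdominated (f_ : nat -> T -> R[i]) f (G : T -> R) :
  (forall n, cmeasurable D (f_ n)) ->
  (forall x, D x -> ccvg \oo (f_^~ x) (f x)) ->
  mu.-integrable D (EFin \o G) ->
  (forall n x, D x -> normc (f_ n x) <= G x) ->
  cintegrable mu D f /\ ccvg \oo (fun n => cintegral mu D (f_ n)) (cintegral mu D f).
Proof.
move=> mf ff iG fG; have mlim := cmeasurable_ccvg mf ff.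
have key (h_ : nat -> T -> R) (h : T -> R) : (forall n, measurable_fun D (h_ n)) ->
    measurable_fun D h -> (forall x, D x -> h_ n x @[n --> \oo] --> h x) ->
    (forall n x, D x -> `|h_ n x| <= G x) ->
    mu.-integrable D (EFin \o h) /\
    (\int[mu]_(x in D) h_ n x) @[n --> \oo] --> \int[mu]_(x in D) h x.
  move=> mh_ mh hh hG.
  have [||||ih _ cv] := @dominated_convergence _ _ _ mu _ mD (fun n => EFin \o h_ n)
    (EFin \o h) (EFin \o G) _ _ _ iG _.
  - by move=> n; exact/measurable_EFinP.
  - exact/measurable_EFinP.
  - by apply: aeW => x Dx; apply: cvg_EFin; [exact: nearW|exact: hh].
  - by apply: aeW => x n Dx; rewrite lee_fin; exact: hG.
  split => //.
  have : [sequence \int[mu]_(x in D) (EFin \o h_ n) x]_n%E @ \oo --> (\int[mu]_(x in D) h x)%:E.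
    by rewrite fineK//; exact: integrable_fin_num.
  by move/fine_cvgP => [].
have [ir cr] := key _ _ (fun n => (mf n).1) mlim.1 (fun x Dx => (ff x Dx).1)
  (fun n x Dx => le_trans (normc_ge_absRe _) (fG n x Dx)).
have [ii ci] := key _ _ (fun n => (mf n).2) mlim.2 (fun x Dx => (ff x Dx).2)
  (fun n x Dx => le_trans (normc_ge_absIm _) (fG n x Dx)).
by split.
Qed.

End complex_integration.

(** * Fubini on boxes and characters of the torus *)

Section lebesgue_box.
Variable R : realType.
Local Notation leb := (@lebesgue_measure R).

Definition box d (I : 'I_d -> set (measurableTypeR R)) :
  set (d.-tuple (measurableTypeR R)) := [set x | forall i, I i (tnth x i)].

Lemma measurable_box d (I : 'I_d -> set (measurableTypeR R)) :
  (forall i, measurable (I i)) -> measurable (box I).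
Proof.
move=> mI; rewrite (_ : box I = \bigcap_(i in [set: 'I_d]) ((@tnth _ _ ^~ i) @^-1` I i)).
  apply: fin_bigcap_measurable => // i _; rewrite -[X in measurable X]setTI.
  exact: measurable_tnth.
by apply/seteqP; split => x /= h; [move=> i _; exact: h|move=> i; exact: (h i)].
Qed.

Lemma lebesgue_box_lty d (I : 'I_d -> set (measurableTypeR R)) :
  (forall i, measurable (I i)) -> (forall i, (leb (I i) < +oo)%E) ->
  (lebesgue_tuple R d (box I) < +oo)%E.
Proof.
move=> mI fI; rewrite lebesgue_tuple_box//.
have h i : leb (I i) \is a fin_num by rewrite ge0_fin_numE ?fI.
suff : (\prod_(i < d) leb (I i))%E \is a fin_num; last first.
  by elim/big_ind: _ => // x y; exact: fin_numM.
by rewrite fin_numE ltey => /andP[].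
Qed.

Lemma lebesgue_tuple_sigma_finite d : sigma_finite setT (lebesgue_tuple R d).
Proof.
pose F (n : nat) := box (fun _ : 'I_d => `[- n%:R, n%:R]%classic : set (measurableTypeR R)).
exists F.
  apply/seteqP; split => // x _.
  pose M := \sum_(i < d) `|tnth x i|.
  have M0 : 0 <= M by exact: sumr_ge0.
  exists (Num.trunc M).+1 => // i; rewrite /= in_itv /= -ler_norml.
  apply: (@le_trans _ _ M); last by apply/ltW; exact: truncnS_gt.
  by rewrite /M (bigD1 i)//= lerDl sumr_ge0.
move=> n; split; first by apply: measurable_box.
apply: lebesgue_box_lty => // i.
by rewrite lebesgue_measure_itv/=; case: ifP => // _; rewrite -EFinB ltry.
Qed.

(* [lebesgue_tuple] as a plain function, so that it can carry the sigma-finite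
   structure that Fubini's theorem asks for. *)
Definition lebesgue_tuple_fun d : set (d.-tuple (measurableTypeR R)) -> \bar R :=
  lebesgue_tuple R d.
HB.instance Definition _ d := Measure.copy (@lebesgue_tuple_fun d) (lebesgue_tuple R d).
HB.instance Definition _ d := Measure_isSigmaFinite.Build _ _ _ (@lebesgue_tuple_fun d)
  (lebesgue_tuple_sigma_finite d).

Section cons.
Variables (n : nat) (m2 : {sigma_finite_measure set (n.-tuple (measurableTypeR R)) -> \bar R}).
Variables (I : set (measurableTypeR R)) (B : set (n.-tuple (measurableTypeR R))).
Hypotheses (mI : measurable I) (mB : measurable B).
Hypotheses (fI : (leb I < +oo)%E) (fB : (m2 B < +oo)%E).

Let D : set (n.+1.-tuple (measurableTypeR R)) :=
  [set x | I (thead x) /\ B [tuple of behead x]].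

Let mD : measurable D.
Proof.
rewrite (_ : D = (fun x => (@tnth _ _ ^~ ord0) x) @^-1` I `&`
  (fun x : n.+1.-tuple (measurableTypeR R) => [tuple of behead x]) @^-1` B)//.
apply: measurableI.
- by rewrite -[X in measurable X]setTI; exact: measurable_tnth.
- by rewrite -[X in measurable X]setTI; exact: measurable_behead.
Qed.

(** Extended by zero outside [I] and [B], both factors become functions on whole spaces; the
    integral over [D] is then the pushforward of one over the product, where Fubini separates the
    variables. The bounds by 1 and the finite measures supply integrability. *)
Lemma Rintegral_cons (a : R -> R) (b : n.-tuple R -> R) :
  measurable_fun setT a -> measurable_fun setT b ->
  (forall x, `|a x| <= 1) -> (forall y, `|b y| <= 1) ->
  \int[lebesgue_cons m2]_(x in D) (a (thead x) * b [tuple of behead x]) =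
  (\int[leb]_(x in I) a x) * (\int[m2]_(y in B) b y).
Proof.
move=> ma mb a1 b1.

pose A := a \_ I; pose C := b \_ B.
have mA : measurable_fun setT A.
  by apply/(measurable_restrictT _ mI); exact: measurable_funTS.
have mC : measurable_fun setT C.
  by apply/(measurable_restrictT _ mB); exact: measurable_funTS.
pose h (z : measurableTypeR R * n.-tuple (measurableTypeR R)) := A z.1 * C z.2.
have mh : measurable_fun setT h.
  by apply: measurable_funM; [exact: measurableT_comp mA measurable_fst|
    exact: measurableT_comp mC measurable_snd].
have hE : h = (fun z => a z.1 * b z.2) \_ (I `*` B).
  apply/funext => -[x y]; rewrite /h /A /C !patchE /= in_setX/=.
  by case: (x \in I); case: (y \in B); rewrite ?mul0r ?mulr0.
have ih (m : {measure set (measurableTypeR R * n.-tuple (measurableTypeR R)) -> \bar R}) :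
    (m (I `*` B) < +oo)%E -> m.-integrable setT (EFin \o h).
  move=> mIB; have mIxB : measurable (I `*` B) by exact: measurableX.
  rewrite (_ : EFin \o h = (EFin \o (fun z => a z.1 * b z.2)) \_ (I `*` B)).
    apply/(integrable_mkcond _ mIxB); apply: measurable_bounded_integrable => //.
      apply: measurable_funTS; apply: measurable_funM.
        exact: measurableT_comp ma measurable_fst.
      exact: measurableT_comp mb measurable_snd.
    by apply: (@le_bounded _ _ _ _ 1) => z _; rewrite normrM mulr_ile1.
  by apply/funext => z; rewrite hE /= !patchE /=; case: ifP.
have fin2 : (leb I * m2 B < +oo)%E.
  by rewrite lte_mul_pinfty// ge0_fin_numE.
have ih1 : (leb \x m2)%E.-integrable setT (EFin \o h).
  by apply: ih; rewrite /= product_measure1E.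
have ih2 : (leb \x^ m2)%E.-integrable setT (EFin \o h).
  by apply: ih; rewrite /= product_measure2E.
rewrite Rintegral_mkcond /Rintegral.
transitivity (fine (\int[leb \x^ m2]_z (h z)%:E)).
  congr fine.
  pose g (x : n.+1.-tuple (measurableTypeR R)) := A (thead x) * C [tuple of behead x].
  have mg : measurable_fun setT g.
    apply: measurable_funM; first exact: measurableT_comp mA (measurable_tnth _).
    exact: measurableT_comp mC (@measurable_behead _ _ n).
  have gh z : g (tuple_cons z) = h z.
    by rewrite /g /h theadE; congr (_ * C _); apply: val_inj.
  have := @integral_pushforward _ _ _ _ R _ (@measurable_tuple_cons R n)
    (leb \x^ m2)%E setT (EFin \o g).
  have -> : (EFin \o g) \o @tuple_cons R n = EFin \o h by apply/funext => z; rewrite /= gh.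
  rewrite preimage_setT => <- //; last exact/measurable_EFinP.
  apply: eq_integral => x _; congr EFin; rewrite /g /A /C !patchE.
  rewrite (_ : (x \in D) = (thead x \in I) && ([tuple of behead x] \in B)).
    by case: (thead x \in I); case: (_ \in B); rewrite ?mul0r ?mulr0.
  by apply/idP/andP; rewrite !inE.
rewrite -integral12_prod_meas2//.
have fC : (\int[m2]_y (C y)%:E)%E \is a fin_num.
  apply: integrable_fin_num => //.
  rewrite (_ : (fun y => _) = (EFin \o b) \_ B).
    apply/(integrable_mkcond _ mB); apply: measurable_bounded_integrable => //.
      exact: measurable_funTS.
    by apply: (@le_bounded _ _ _ _ 1) => z _.
  by apply/funext => z; rewrite /C !patchE /=; case: ifP.
have iC : m2.-integrable setT (EFin \o C).
  rewrite (_ : EFin \o C = (EFin \o b) \_ B).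
    apply/(integrable_mkcond _ mB); apply: measurable_bounded_integrable => //.
      exact: measurable_funTS.
    by apply: (@le_bounded _ _ _ _ 1) => z _.
  by apply/funext => z; rewrite /C /= !patchE /=; case: ifP.
have iA : leb.-integrable setT (EFin \o A).
  rewrite (_ : EFin \o A = (EFin \o a) \_ I).
    apply/(integrable_mkcond _ mI); apply: measurable_bounded_integrable => //.
      exact: measurable_funTS.
    by apply: (@le_bounded _ _ _ _ 1) => z _.
  by apply/funext => z; rewrite /A /= !patchE /=; case: ifP.
transitivity (fine (\int[leb]_x ((A x)%:E * \int[m2]_y (C y)%:E))%E).
  congr fine; apply: eq_integral => x _; rewrite /fubini_F /=.
  under eq_integral do rewrite /h /= EFinM.
  by rewrite integralZl.
rewrite -(fineK fC).
rewrite integralZr// fineM//; last exact: integrable_fin_num.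
by congr (_ * _); apply/esym; exact: Rintegral_mkcond.
Qed.

Lemma cintegral_cons (f : R -> R[i]) (g : n.-tuple R -> R[i]) :
  cmeasurable setT f -> cmeasurable setT g ->
  (forall x, normc (f x) <= 1) -> (forall y, normc (g y) <= 1) ->
  cintegral (lebesgue_cons m2) D (fun x => f (thead x) * g [tuple of behead x]) =
  cintegral leb I f * cintegral m2 B g.
Proof.
move=> [fr fi] [gr gi] f1 g1.
have fr1 x : `|Re (f x)| <= 1 := le_trans (normc_ge_absRe _) (f1 x).
have fi1 x : `|Im (f x)| <= 1 := le_trans (normc_ge_absIm _) (f1 x).
have gr1 x : `|Re (g x)| <= 1 := le_trans (normc_ge_absRe _) (g1 x).
have gi1 x : `|Im (g x)| <= 1 := le_trans (normc_ge_absIm _) (g1 x).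
have fD : (lebesgue_cons m2 D < +oo)%E.
  rewrite /lebesgue_cons /pushforward (_ : _ @^-1` D = I `*` B).
    by rewrite product_measure2E// lte_mul_pinfty// ge0_fin_numE.
  apply/funext => -[x y]; rewrite /D /preimage /= theadE.
  by congr (_ /\ B _); exact: val_inj.
have ifg (a : R -> R) (b : n.-tuple R -> R) : measurable_fun setT a -> measurable_fun setT b ->
    (forall x, `|a x| <= 1) -> (forall y, `|b y| <= 1) ->
    (lebesgue_cons m2).-integrable D
      (EFin \o (fun x : n.+1.-tuple R => a (thead x) * b [tuple of behead x])).
  move=> ma mb a1 b1; apply: measurable_bounded_integrable => //.
    apply: measurable_funTS; apply: measurable_funM.
      exact: measurableT_comp ma (measurable_tnth _).
    exact: measurableT_comp mb (@measurable_behead _ _ n).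
  by apply: (@le_bounded _ _ _ _ 1) => z _; rewrite normrM mulr_ile1.
apply: eq_ReIm; rewrite ?cReM ?cImM /=.
- under eq_Rintegral do rewrite cReM.
  rewrite (RintegralB mD (ifg _ _ fr gr fr1 gr1) (ifg _ _ fi gi fi1 gi1)).
  by rewrite (Rintegral_cons fr gr fr1 gr1) (Rintegral_cons fi gi fi1 gi1).
- under eq_Rintegral do rewrite cImM.
  rewrite (RintegralD mD (ifg _ _ fr gi fr1 gi1) (ifg _ _ fi gr fi1 gr1)).
  by rewrite (Rintegral_cons fr gi fr1 gi1) (Rintegral_cons fi gr fi1 gr1).
Qed.

End cons.

Lemma cintegral_box d (I : 'I_d -> set (measurableTypeR R)) (f : 'I_d -> R -> R[i]) :
  (forall i, measurable (I i)) -> (forall i, (leb (I i) < +oo)%E) ->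
  (forall i, cmeasurable setT (f i)) -> (forall i x, normc (f i x) <= 1) ->
  cintegral (lebesgue_tuple R d) (box I) (fun x => \prod_i f i (tnth x i)) =
  \prod_i cintegral leb (I i) (f i).
Proof.
elim: d I f => [|d IH] I f mI fI mf f1.
  rewrite big_ord0 /cintegral; under eq_Rintegral do rewrite big_ord0 /=.
  under [X in _ +i* X]eq_Rintegral do rewrite big_ord0 /=.
  rewrite !Rintegral_cst ?mul0r ?mul1r; try exact: measurable_box.
  by rewrite lebesgue_tuple_box// big_ord0.
have E := @cintegral_cons d (@lebesgue_tuple_fun d) (I ord0) (box (fun i => I (lift ord0 i))) (mI _)
  (measurable_box (fun i => mI _)) (fI _)
  (lebesgue_box_lty (fun i => mI _) (fun i => fI _))
  (f ord0) (fun y => \prod_i f (lift ord0 i) (tnth y i)) (mf _).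
rewrite big_ord_recl -IH// -E//; last 2 first.
- by apply: cmeasurable_prod => i; split;
    [exact: measurableT_comp (mf _).1 (measurable_tnth _)|
     exact: measurableT_comp (mf _).2 (measurable_tnth _)].
- by move=> y; exact: normc_prod_le1.
have -> : box I = [set x | I ord0 (thead x) /\ box (fun i => I (lift ord0 i)) [tuple of behead x]].
  apply/funext => x; apply/propext; split=> [Ix|[I0 Ix] i].
    by split=> [|i]; [exact: Ix|rewrite tnth_behead -lift0 inord_val; exact: Ix].
  by have [j ->|->//] := unliftP ord0 i; have := Ix j; rewrite tnth_behead -lift0 inord_val.
apply: eq_cintegral => x _; rewrite big_ord_recl; congr (_ * _).
by apply: eq_bigr => i _; rewrite tnth_behead -lift0 inord_val.
Qed.

End lebesgue_box.

(** * Integrals of exponentials on a segment *)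

Section fundamental_theorem.
Variable R : realType.
Local Notation leb := (@lebesgue_measure R).

Lemma integrable_continuous_itv (f : R -> R) (a b : R) : continuous f ->
  leb.-integrable `[a, b]%classic (EFin \o f).
Proof.
move=> cf; apply: continuous_compact_integrable; first exact: segment_compact.
exact: continuous_subspaceT.
Qed.

Lemma Rintegral_derive (f F : R -> R) (a b : R) : a <= b -> continuous f ->
  (forall x : R, is_derive x 1 F (f x)) -> \int[leb]_(x in `[a, b]) f x = F b - F a.
Proof.
rewrite le_eqVlt => /predU1P[->|ab] cf dF.
  by rewrite set_itv1 Rintegral_set1 subrr.
have cF : continuous F.
  move=> x; apply/differentiable_continuous/derivable1_diffP.
  exact: (@ex_derive _ _ _ _ _ _ _ (dF x)).
rewrite /Rintegral (@continuous_FTC2 _ f F)//.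
- exact: continuous_subspaceT.
- split.
  + by move=> x _; exact: (@ex_derive _ _ _ _ _ _ _ (dF x)).
  + by apply: cvg_at_right_filter; exact: cF.
  + by apply: cvg_at_left_filter; exact: cF.
- by move=> x _; rewrite derive1E (@derive_val _ _ _ _ _ _ _ (dF x)).
Qed.

Lemma continuous_cos_lin (c : R) : continuous (fun x : R => cos (c * x)).
Proof.
move=> x; apply: (@continuous_comp _ _ _ ( *%R c) cos); last exact: continuous_cos.
exact: mulrl_continuous.
Qed.

Lemma continuous_sin_lin (c : R) : continuous (fun x : R => sin (c * x)).
Proof.
move=> x; apply: (@continuous_comp _ _ _ ( *%R c) sin); last exact: continuous_sin.
exact: mulrl_continuous.
Qed.

Lemma cintegrable_cis_lin (a b c : R) :
  cintegrable leb `[a, b]%classic (fun x => cis (c * x)).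
Proof.
split; apply: integrable_continuous_itv; [exact: continuous_cos_lin|].
exact: continuous_sin_lin.
Qed.

(** The fundamental theorem of calculus for the two components. The factor ['i%C * c%:C] stays on
    the left, so [c = 0] needs no separate treatment. *)
Lemma cintegral_cis_lin (a b c : R) : a <= b ->
  'i%C * c%:C * cintegral leb `[a, b]%classic (fun x => cis (c * x)) =
  cis (c * b) - cis (c * a).
Proof.
move=> ab.
have dl (x : R) : is_derive x 1 ( *%R c : R -> R) c.
  by apply: is_derive_eq; rewrite ?scaler0 ?add0r; exact: mulr1.
have ds : \int[leb]_(x in `[a, b]) (cos (c * x) * c) = sin (c * b) - sin (c * a).
  apply: (Rintegral_derive (F := fun x => sin (c * x)) ab).
  by move=> x; apply: cvgM; [exact: continuous_cos_lin|exact: cvg_cst].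
have dc : \int[leb]_(x in `[a, b]) (- sin (c * x) * c) = cos (c * b) - cos (c * a).
  apply: (Rintegral_derive (F := fun x => cos (c * x)) ab).
  by move=> x; apply: cvgM; [apply: cvgN; exact: continuous_sin_lin|exact: cvg_cst].
have [ic ii] := cintegrable_cis_lin a b c.
have dc' : - (\int[leb]_(x in `[a, b]) sin (c * x)) * c = cos (c * b) - cos (c * a).
  rewrite -dc mulNr -mulrN -RintegralZr//.
  by apply: eq_Rintegral => x _; rewrite mulrN mulNr.
rewrite RintegralZr// in ds.
by apply: eq_ReIm; rewrite !(cReM, cImM, cReD, cImD, cReN, cImN) /=; lra.
Qed.

End fundamental_theorem.

(** * Orthogonality of the characters of the torus *)

Section torus_characters.
Variables (R : realType) (d : nat) (w : 'rV[R]_d).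
Hypothesis hw : forall i, w ord0 i != 0.
Local Notation leb := (@lebesgue_measure R).
Local Notation mu := (lebesgue_tuple R d).
Local Notation cell := (cell w).
Implicit Types n m : 'rV[int]_d.

Definition char n (x : d.-tuple R) : R[i] := cis (phase w n x).

Lemma charE n x : char n x = cis (phase w n x). Proof. by []. Qed.

Lemma phaseD n m x : phase w (n + m) x = phase w n x + phase w m x.
Proof.
rewrite /phase -big_split; apply: eq_bigr => i _ /=.
by rewrite mxE rmorphD /=; ring.
Qed.

Lemma phaseN n x : phase w (- n) x = - phase w n x.
Proof.
rewrite /phase -sumrN; apply: eq_bigr => i _ /=.
by rewrite mxE rmorphN /=; ring.
Qed.

Lemma phase0 x : phase w 0 x = 0.
Proof. by rewrite /phase big1// => i _; rewrite mxE mulr0 mul0r. Qed.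

Lemma charD n m x : char (n + m) x = char n x * char m x.
Proof. by rewrite /char phaseD cisD. Qed.

Lemma char0 x : char 0 x = 1. Proof. by rewrite /char phase0 cis0. Qed.

Lemma cis_oppE n x : cis (- phase w n x) = char (- n) x.
Proof. by rewrite /char phaseN. Qed.

Lemma normc_char n x : normc (char n x) = 1. Proof. exact: normc_cis. Qed.

Lemma char_periodic n : Defs.periodic w (char n).
Proof.
move=> m x; rewrite /char.
have -> : phase w n [tuple tnth x i + 2 * pi / w ord0 i * (m ord0 i)%:~R | i < d] =
    phase w n x + 2 * pi * (\sum_i n ord0 i * m ord0 i)%:~R.
  rewrite rmorph_sum mulr_sumr /phase -big_split /=; apply: eq_bigr => i _.
  rewrite tnth_mktuple rmorphM /=; move: (hw i) => wi.
  by field.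
by rewrite cisD cis_2pi_int mulr1.
Qed.

Lemma period_gt0 i : 0 < 2 * pi / `|w ord0 i|.
Proof. by rewrite divr_gt0 ?mulr_gt0 ?pi_gt0 ?normr_gt0. Qed.

Let I i : set (measurableTypeR R) := `[0, 2 * pi / `|w ord0 i|[%classic.

Lemma cell_box : cell = box I.
Proof. by apply/funext => x; apply/propext; split=> h i; have := h i; rewrite /I /= in_itv. Qed.

Let mI i : measurable (I i). Proof. exact: measurable_itv. Qed.

Let vI i : leb (I i) = (2 * pi / `|w ord0 i|)%:E.
Proof. by rewrite /I lebesgue_measure_itv /= lte_fin period_gt0 sube0. Qed.

Lemma measurable_cell : measurable (cell : set (d.-tuple (measurableTypeR R))).
Proof. by rewrite cell_box; exact: measurable_box. Qed.

Definition volume : R := \prod_(i < d) (2 * pi / `|w ord0 i|).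

Lemma volume_gt0 : 0 < volume.
Proof. by apply: prodr_gt0 => i _; exact: period_gt0. Qed.

Lemma cell_volume : mu cell = volume%:E.
Proof.
rewrite cell_box lebesgue_tuple_box// /volume.
rewrite (big_morph EFin EFinM (erefl 1%E)); apply: eq_bigr => i _; exact: vI.
Qed.

Lemma cell_lty : (mu cell < +oo)%E. Proof. by rewrite cell_volume ltry. Qed.

Lemma measurable_phase n (D : set (d.-tuple (measurableTypeR R))) :
  measurable_fun D (phase w n).
Proof.
apply: measurable_funTS; apply: measurable_sum => i.
by apply: measurable_funM => //; exact: measurable_tnth.
Qed.

Lemma cmeasurable_char n (D : set (d.-tuple (measurableTypeR R))) : cmeasurable D (char n).
Proof.
split.
- apply: (measurableT_comp (f := cos)); last exact: measurable_phase.
  exact: continuous_measurable_fun (@continuous_cos R).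
- apply: (measurableT_comp (f := sin)); last exact: measurable_phase.
  exact: continuous_measurable_fun (@continuous_sin R).
Qed.

Lemma cintegrable_char n : cintegrable mu cell (char n).
Proof.
apply: (@cintegrable_bounded _ _ _ _ _ _ _ 1).
- exact: measurable_cell.
- exact: cell_lty.
- exact: cmeasurable_char.
- by move=> x _; rewrite normc_char.
Qed.

(** For [k != 0] the exponential takes equal values at both ends of the period, so the right side of
    [cintegral_cis_lin] is zero while the factor in front of the integral is not. *)
Lemma cintegral_period i (k : int) :
  cintegral leb (I i) (fun x => cis (w ord0 i * k%:~R * x)) =
  if k == 0 then (2 * pi / `|w ord0 i|)%:C else 0.
Proof.
have [->|k0] := eqVneq k 0.
  rewrite (@eq_cintegral _ _ _ _ _ _ (fun=> 1)); last by move=> x _; rewrite mulr0 mul0r cis0.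
  by apply: eq_ReIm; rewrite /= Rintegral_cst// ?mul0r// mul1r; exact: (congr1 fine (vI i)).
have L0 := period_gt0 i; set L := 2 * pi / `|w ord0 i| in L0 *.
set c := w ord0 i * k%:~R.
have [ic ii] := cintegrable_cis_lin 0 L c.
have sub : `[0, L[%classic `<=` `[0, L]%classic by exact: subset_itv_co_cc.
have -> : cintegral leb (I i) (fun x => cis (c * x)) =
    cintegral leb `[0, L]%classic (fun x => cis (c * x)).
  apply: eq_ReIm; apply: Rintegral_itv_bndo_bndc.
  - by apply: integrableS ic => //; exact: measurable_itv.
  - by apply: integrableS ii => //; exact: measurable_itv.
have := cintegral_cis_lin c (ltW L0); rewrite mulr0 cis0.
have -> : cis (c * L) = 1.
  (* The period contains [|w_i|] and [c] contains [w_i]: their product is [2 pi k] up to the sign of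
     [w_i]. *)
  have [wp|wn] := ltP 0 (w ord0 i).
    have -> : c * L = 2 * pi * k%:~R by rewrite /c /L gtr0_norm//; field; rewrite gt_eqF.
    exact: cis_2pi_int.
  have -> : c * L = 2 * pi * (- k)%:~R.
    by rewrite /c /L ler0_norm// rmorphN /=; move: (hw i) => wi; field.
  exact: cis_2pi_int.
rewrite subrr => /eqP; rewrite mulf_eq0 => /predU1P[/eqP|/eqP//].
rewrite mulf_eq0 => /orP[/eqP[]/eqP|/eqP[]/eqP]; first by rewrite oner_eq0.
by rewrite mulf_eq0 (negbTE (hw i)) intr_eq0 (negbTE k0).
Qed.

Lemma cintegral_char n :
  cintegral mu cell (char n) = if n == 0 then volume%:C else 0.
Proof.
have -> : cintegral mu cell (char n) = \prod_i cintegral leb (I i)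
    (fun x => cis (w ord0 i * (n ord0 i)%:~R * x)).
  rewrite cell_box -(cintegral_box (f := fun i x => cis (w ord0 i * (n ord0 i)%:~R * x)))//.
  - by apply: eq_cintegral => x _; rewrite /char /phase cis_sum.
  - by move=> i; rewrite vI ltry.
  - move=> i; split.
    + exact: continuous_measurable_fun (@continuous_cos_lin _ _).
    + exact: continuous_measurable_fun (@continuous_sin_lin _ _).
  - by move=> i x; rewrite normc_cis.
have [->|n0] := eqVneq n 0.
  under eq_bigr do rewrite cintegral_period mxE eqxx.
  by rewrite -rmorph_prod.
have [i ni] : exists i, n ord0 i != 0.
  apply/existsP; apply: contra_neqT n0 => /existsPn h.
  by apply/rowP => i; rewrite mxE; have := h i; rewrite negbK => /eqP.
by rewrite (bigD1 i)//= cintegral_period (negbTE ni) mul0r.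
Qed.

End torus_characters.

(** * Uniqueness of Fourier coefficients *)

Section trigonometric_order.
Variable R : realType.
Implicit Types c y : R.

Lemma le_cos_0pi c y : 0 <= y <= pi -> 0 <= c <= pi -> (cos c <= cos y) = (y <= c).
Proof. by move=> yp cp; rewrite !leNgt ltr_cos ?in_itv. Qed.

Lemma cos_subpi y : cos y = - cos (y - pi).
Proof. by rewrite -[in LHS](subrK pi y) cosDpi. Qed.

Lemma sin_subpi y : sin y = - sin (y - pi).
Proof. by rewrite -[in LHS](subrK pi y) sinDpi. Qed.

Lemma sin_ge0_02pi y : 0 <= y < 2 * pi -> (0 <= sin y) = (y <= pi).
Proof.
move=> /andP[y0 y2]; have [yp|yp] := leP y pi; first by rewrite sin_ge0_pi ?y0.
apply/negbTE; rewrite -ltNge sin_subpi oppr_lt0 sin_gt0_pi// subr_gt0 yp/=.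
by lra.
Qed.

(** Initial arcs of the circle are cut out by sign conditions on [sin] and [cos] alone; this later
    brings half-spaces within reach of the multipliers. Up to [pi] the arc lies in the upper half
    circle, where [cos] decreases. *)
Lemma le_arc_small c y : 0 <= y < 2 * pi -> 0 <= c <= pi ->
  (y <= c) = (0 <= sin y) && (cos c <= cos y).
Proof.
move=> yp cp; rewrite sin_ge0_02pi//; have [ypi|ypi] := leP y pi.
  by rewrite le_cos_0pi//; case/andP: yp => ->.
by apply/negbTE; rewrite -ltNge; case/andP: cp => _ /le_lt_trans; exact.
Qed.

(** Past [pi] the arc contains the whole upper half circle, and on the lower half [cos]
    increases. *)
Lemma le_arc_large c y : 0 <= y < 2 * pi -> pi <= c <= 2 * pi ->
  (y <= c) = (0 <= sin y) || (cos y <= cos c).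
Proof.
move=> yp /andP[cp1 cp2]; rewrite sin_ge0_02pi//; have [ypi|ypi] /= := leP y pi.
  exact: le_trans cp1.
have /andP[y0 y2] := yp.
by rewrite (cos_subpi y) (cos_subpi c) lerN2 le_cos_0pi ?lerD2r//; apply/andP; split; lra.
Qed.

End trigonometric_order.

Section fourier_uniqueness.
Variables (R : realType) (d : nat) (w : 'rV[R]_d).
Hypothesis hw : forall i, w ord0 i != 0.
Local Notation mu := (lebesgue_tuple R d).
Local Notation cell := (cell w : set (d.-tuple (measurableTypeR R))).
Local Notation char := (char w).
Local Notation T := (d.-tuple (measurableTypeR R)).
Implicit Types (n m : 'rV[int]_d) (f : T -> R[i]) (g h : T -> R).

(** All [n] are tested, so [char n] can stand for [char (- n)]: up to the volume factor these
    integrals are all the Fourier coefficients of [f]. *)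
Definition annihilated f : Prop := cintegrable mu cell f /\
  forall n, cintegral mu cell (fun x => f x * char n x) = 0.

(** The whole class of annihilated functions must be preserved, rather than one integral vanish:
    this makes multipliers stable under products. *)
Definition multiplier g : Prop := [/\ measurable_fun setT g,
  exists M, forall x, `|g x| <= M &
  forall f, annihilated f -> annihilated (fun x => f x * (g x)%:C)].

Let mcell := measurable_cell w.

Lemma cintegrableM_char f n : cintegrable mu cell f ->
  cintegrable mu cell (fun x => f x * char n x).
Proof.
move=> cf; apply: (@cintegrableM_bounded _ _ _ _ _ mcell _ _ 1) => //.
  exact: cmeasurable_char.
by move=> x _; rewrite normc_char.
Qed.

Lemma eq_annihilated f f' : (forall x, cell x -> f x = f' x) ->
  annihilated f -> annihilated f'.
Proof.
move=> ff' [cf f0]; split; first exact: (eq_cintegrable mcell ff').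
by move=> n; rewrite -(f0 n); apply: eq_cintegral => x cx; rewrite ff'.
Qed.

Lemma annihilatedZ z f : annihilated f -> annihilated (fun x => z * f x).
Proof.
move=> [cf f0]; split; first exact: cintegrableZ.
move=> n; under eq_cintegral do rewrite -mulrA.
by rewrite cintegralZ ?f0 ?mulr0//; exact: cintegrableM_char.
Qed.

Lemma annihilatedD f f' : annihilated f -> annihilated f' ->
  annihilated (fun x => f x + f' x).
Proof.
move=> [cf f0] [cf' f'0]; split; first exact: cintegrableD.
move=> n; rewrite (@eq_cintegral _ _ _ _ _ _ (fun x => f x * char n x + f' x * char n x)).
  by rewrite cintegralD ?f0 ?f'0 ?addr0//; exact: cintegrableM_char.
by move=> x _; rewrite mulrDl.
Qed.

(** Multiplication by a character only shifts the modes that are tested; this is why trigonometric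
    functions are multipliers. *)
Lemma annihilatedM_char f m : annihilated f -> annihilated (fun x => f x * char m x).
Proof.
move=> [cf f0]; split; first exact: cintegrableM_char.
by move=> n; rewrite -(f0 (m + n)); apply: eq_cintegral => x _; rewrite charD mulrA.
Qed.

Lemma annihilated_ccvg (f_ : nat -> T -> R[i]) f (G : T -> R) :
  (forall k, annihilated (f_ k)) ->
  (forall x, cell x -> ccvg \oo (f_^~ x) (f x)) ->
  mu.-integrable cell (EFin \o G) ->
  (forall k x, cell x -> normc (f_ k x) <= G x) -> annihilated f.
Proof.
move=> af ff iG fG.
have mf_ k : cmeasurable cell (f_ k) by exact: cintegrable_measurable (af k).1.
split; first by have [] := cdominated mcell mf_ ff iG fG.
move=> n.
have [] := @cdominated _ _ _ mu _ mcell (fun k x => f_ k x * char n x)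
  (fun x => f x * char n x) G.
- by move=> k; apply: cmeasurableM => //; exact: cmeasurable_char.
- by move=> x cx; apply: ccvgM; [exact: ff|exact: ccvg_cst].
- exact: iG.
- by move=> k x cx; rewrite ComplexField.Normc.normcM normc_char mulr1; exact: fG.
move=> _ /ccvg_unique; apply.
rewrite (_ : (fun k => _) = fun=> 0); first exact: ccvg_cst.
by apply/funext => k; case: (af k).
Qed.

Lemma multiplier_cst (r : R) : multiplier (fun=> r).
Proof.
split; first exact: measurable_cst.
  by exists `|r|.
move=> f /(annihilatedZ r%:C); apply: eq_annihilated => x _.
by rewrite mulrC.
Qed.

Lemma multiplierD g h : multiplier g -> multiplier h -> multiplier (fun x => g x + h x).
Proof.
move=> [mg [M gM] ag] [mh [N hN] ah]; split; first exact: measurable_funD.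
  by exists (M + N) => x; rewrite (le_trans (ler_normD _ _))// lerD.
move=> f af; have := annihilatedD (ag f af) (ah f af); apply: eq_annihilated => x _.
by rewrite -mulrDr -rmorphD.
Qed.

Lemma multiplierM g h : multiplier g -> multiplier h -> multiplier (fun x => g x * h x).
Proof.
move=> [mg [M gM] ag] [mh [N hN] ah]; split; first exact: measurable_funM.
  by exists (M * N) => x; rewrite normrM ler_pM.
move=> f /ag/ah; apply: eq_annihilated => x _.
by rewrite -mulrA -rmorphM.
Qed.

Lemma multiplierZ (r : R) g : multiplier g -> multiplier (fun x => r * g x).
Proof. exact: multiplierM (multiplier_cst r). Qed.

Lemma multiplierB g h : multiplier g -> multiplier h -> multiplier (fun x => g x - h x).
Proof.
move=> mg /(multiplierZ (-1)) mh.
by have := multiplierD mg mh; under eq_fun do rewrite mulN1r.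
Qed.

Lemma multiplier_lim (g_ : nat -> T -> R) g (M : R) : (forall k, multiplier (g_ k)) ->
  (forall k x, `|g_ k x| <= M) -> (forall x, g_ k x @[k --> \oo] --> g x) ->
  multiplier g.
Proof.
move=> mg_ gM gg; split.
- apply: (measurable_fun_cvg (h := g_)) => [k|x _]; last exact: gg.
  by case: (mg_ k).
- exists M => x; have cg : `|g_ k x| @[k --> \oo] --> `|g x| by apply: cvg_norm; exact: gg.
  rewrite -(cvg_lim _ cg)//.
  by apply: limr_le; [exact: cvgP cg|apply: nearW].
- move=> f af; have [cf f0] := af.
  apply: (@annihilated_ccvg (fun k x => f x * (g_ k x)%:C) _
    (fun x => (`|Re (f x)| + `|Im (f x)|) * M)).
  + by move=> k; case: (mg_ k) => _ _; exact.
  + move=> x _; apply: ccvgM; first exact: ccvg_cst.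
    by split; [exact: gg|exact: cvg_cst].
  + have iN : mu.-integrable cell (fun x => (`|(Re (f x))%:E| + `|(Im (f x))%:E|)%E).
      by apply: integrableD => //; apply: integrable_abse; case: cf.
    have := integrableZr mcell M iN; apply: eq_integrable => // x _.
  + move=> k x _; rewrite ComplexField.Normc.normcM normc_real ler_pM ?normc_ge0//.
    exact: normc_le_ReIm.
Qed.

Lemma multiplierX g k : multiplier g -> multiplier (fun x => g x ^+ k).
Proof.
move=> mg; elim: k => [|k IH]; first exact: (multiplier_cst 1).
by under eq_fun do rewrite exprS; exact: multiplierM.
Qed.

(* Monotone polynomial iteration converging to [|a|] when [|a| <= 1]. *)
Fixpoint abs_approx (a : R) (k : nat) : R :=
  if k is j.+1 then abs_approx a j + 2^-1 * (a ^+ 2 - abs_approx a j ^+ 2) else 0.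

(** With [b = |a|] and [q] the current value, the new error is [(b - q) (1 - (b + q) / 2)]. As
    [0 <= q <= b <= 1], the second factor lies in [[0, 1 - b / 2]], which keeps the values below [b]
    and makes the error decay geometrically. *)
Lemma abs_approx_bounds (a : R) k : `|a| <= 1 ->
  0 <= abs_approx a k <= `|a| /\ `|a| - abs_approx a k <= (1 - 2^-1 * `|a|) ^+ k.
Proof.
move=> a1; have a0 := normr_ge0 a; elim: k => [|k [/andP[q0 qa] IH]] /=.
  by rewrite lexx a0 subr0 expr0.
have -> : a ^+ 2 = `|a| ^+ 2 by rewrite real_normK ?num_real.
set q := abs_approx a k in q0 qa IH *; set b := `|a| in a1 a0 q0 qa IH *.
have e : b - (q + 2^-1 * (b ^+ 2 - q ^+ 2)) = (b - q) * (1 - 2^-1 * (b + q)) by field.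
split; first by apply/andP; split; nra.
rewrite e exprSr; apply: ler_pM; rewrite ?subr_ge0//; lra.
Qed.

Lemma multiplier_abs g : multiplier g -> (forall x, `|g x| <= 1) ->
  multiplier (fun x => `|g x|).
Proof.
move=> mg g1; apply: (@multiplier_lim (fun k x => abs_approx (g x) k) _ 1).
- elim=> [|k IH] /=; first exact: multiplier_cst.
  apply: multiplierD => //; apply: multiplierZ.
  by apply: multiplierB; exact: multiplierX.
- move=> k x; have [/andP[q0 qg] _] := abs_approx_bounds k (g1 x).
  by rewrite ger0_norm// (le_trans qg).
(* At a zero of [g] the geometric ratio is 1 and gives no decay, but the bounds then force every
   approximation to be 0. *)
- move=> x; have [g0|g0] := eqVneq (g x) 0.
    rewrite (_ : abs_approx (g x) = fun=> `|g x|); first exact: cvg_cst.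
    apply/funext => k; apply/eqP; rewrite eq_le.
    have [/andP[q0 qg] _] := abs_approx_bounds k (g1 x).
    by rewrite qg/= g0 normr0; rewrite g0 in q0.
  have gp : 0 < `|g x| by rewrite normr_gt0.
  have gx1 := g1 x.
  have h : geometric (1 : R) (1 - 2^-1 * `|g x|) @ \oo --> 0.
    by apply: cvg_geometric; rewrite ger0_norm; lra.
  apply/cvgrPdist_le => e e0; near=> k.
  have [/andP[q0 qg] qe] := abs_approx_bounds k (g1 x).
  rewrite ger0_norm ?subr_ge0// (le_trans qe)//.
  near: k; have /cvgrPdist_le/(_ e e0) := h; apply: filterS => k /=.
  by rewrite sub0r normrN mul1r; apply: le_trans; exact: ler_norm.
Unshelve. all: by end_near. Qed.

(** With [hp] the positive part of [g] scaled into [[0, 1]], the functions [1 - (1 - hp)^k] tend to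
    1 where [g] is positive and vanish elsewhere. *)
Lemma multiplier_pos g : multiplier g -> multiplier (fun x => ((0 < g x)%R : nat)%:R).
Proof.
move=> mg; have [_ [M gM] _] := mg.
have M1 : 0 < 1 + `|M| by rewrite ltr_pwDl.
pose h x := (1 + `|M|)^-1 * g x.
have mh : multiplier h by exact: multiplierZ.
have h1 x : `|h x| <= 1.
  rewrite normrM normfV (gtr0_norm M1) mulrC ler_pdivrMr// mul1r.
  by rewrite (le_trans (gM x))// (le_trans (ler_norm _))// lerDr.
pose hp x := 2^-1 * (h x + `|h x|).
have mhp : multiplier hp by apply/multiplierZ/multiplierD => //; exact: multiplier_abs.
have hp01 x : 0 <= hp x <= 1.
  by have := h1 x; have := ler_norm (h x); have := ler_norm (- h x); rewrite normrN /hp; lra.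
apply: (@multiplier_lim (fun k x => 1 - (1 - hp x) ^+ k) _ 1).
- move=> k; apply: multiplierB; first exact: multiplier_cst.
  by apply/multiplierX/multiplierB => //; exact: multiplier_cst.
- move=> k x; have /andP[p0 p1] := hp01 x.
  have : 0 <= (1 - hp x) ^+ k <= 1 by rewrite exprn_ge0 ?exprn_ile1//; lra.
  by move=> /andP[? ?]; rewrite ger0_norm; lra.
- move=> x; have [gp|gn] := ltP 0 (g x).
    have hx : 0 < hp x.
      have : 0 < h x by rewrite /h mulr_gt0 ?invr_gt0.
      by rewrite /hp; have := normr_ge0 (h x); lra.
    rewrite -[X in _ --> X](subr0 (1 : R)); apply: cvgB; first exact: cvg_cst.
    apply: cvg_expr; have /andP[p0 p1] := hp01 x.
    by rewrite ger0_norm; lra.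
  have -> : hp x = 0.
    have : h x <= 0 by rewrite /h pmulr_rle0 ?invr_gt0.
    by rewrite /hp => /ler0_norm ->; rewrite subrr mulr0.
  under eq_fun do rewrite subr0 expr1n subrr.
  exact: cvg_cst.
Qed.

Let S : set (set T) := [set A | measurable A /\ multiplier (\1_A)].

(** Annihilation sees only values in the cell, so a measurable set may be exchanged for one with the
    same trace there; half-spaces have their trigonometric description only inside the cell. *)
Let S_ext (A B : set T) : measurable A -> A `&` cell = B `&` cell -> S B -> S A.
Proof.
move=> mA AB [mB [_ _ aB]]; split => //; split.
- exact: measurable_indic.
- exists 1 => x; rewrite indicE; case: (x \in A); rewrite ?normr1// normr0; exact: ler01.
- move=> f /aB; apply: eq_annihilated => x cx; congr (_ * (_)%:C); rewrite !indicE.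
  congr (_%:R); congr nat_of_bool; apply/idP/idP; rewrite !inE => Ax.
  + have : (B `&` cell) x by [].
    by rewrite -AB => -[].
  + have : (A `&` cell) x by [].
    by rewrite AB => -[].
Qed.

Let S_setT : S setT.
Proof.
split => //; have := multiplier_cst 1; congr multiplier.
by apply/funext => x; rewrite indicT.
Qed.

Let S_setC A : S A -> S (~` A).
Proof.
move=> [mA sA]; split; first exact: measurableC.
have := multiplierB (multiplier_cst 1) sA; congr multiplier.
by apply/funext => x; rewrite !indicE in_setC; case: (x \in A); rewrite ?subrr ?subr0.
Qed.

Let S_setI A B : S A -> S B -> S (A `&` B).
Proof.
move=> [mA sA] [mB sB]; split; first exact: measurableI.
have := multiplierM sA sB; congr multiplier.
by apply/funext => x; rewrite indicI.
Qed.

Let S_setU A B : S A -> S B -> S (A `|` B).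
Proof.
by move=> sA sB; rewrite -(setCK (A `|` B)) setCU; apply/S_setC/S_setI; exact: S_setC.
Qed.

Let S_bigcup (F : (set T)^nat) : (forall i, S (F i)) -> S (\bigcup_i F i).
Proof.
move=> sF; have sU k : S (\big[setU/set0]_(i < k) F i).
  elim: k => [|k IH]; last by rewrite big_ord_recr; exact: S_setU.
  by rewrite big_ord0 -setCT; exact: S_setC.
split; first by apply: bigcup_measurable => i _; case: (sF i).
apply: (@multiplier_lim (fun k => \1_(\big[setU/set0]_(i < k) F i)) _ 1).
- by move=> k; case: (sU k).
- by move=> k x; rewrite indicE; case: (_ \in _); rewrite ?normr1// normr0; exact: ler01.
- move=> x; rewrite indicE; have [xU|xU] := boolP (x \in \bigcup_i F i).
    move: xU; rewrite inE => -[j _ Fj].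
    apply: cvg_near_cst; exists j.+1 => // k /= jk.
    rewrite indicE mem_set// -bigcup_mkord; by exists j.
  apply: cvg_near_cst; apply: nearW => k; rewrite indicE memNset// -bigcup_mkord => -[j _ Fj].
  by move: xU; rewrite notin_setE; apply; exists j.
Qed.

Let S_pos g : multiplier g -> S [set x | 0 < g x].
Proof.
move=> mg; split.
  rewrite (_ : [set x | _] = setT `&` g @^-1` `]0, +oo[%classic).
    by case: mg => mg _ _; apply: mg => //; exact: measurable_itv.
  by rewrite setTI; apply/seteqP; split => x /=; rewrite in_itv/= andbT.
have := multiplier_pos mg; congr multiplier; apply/funext => x.
rewrite indicE; congr (_%:R); congr nat_of_bool.
by apply/idP/idP; rewrite inE.
Qed.

Let S_ge0 g : multiplier g -> S [set x | 0 <= g x].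
Proof.
move=> /(multiplierZ (-1))/S_pos/S_setC; congr S.
apply/funext => x; apply/propext; rewrite /= mulN1r oppr_gt0.
by split=> [/negP|] ; rewrite leNgt // => /negP.
Qed.

Let multiplier_char2 g (z1 z2 : R[i]) n m : measurable_fun setT g -> (forall x, `|g x| <= 1) ->
  (forall x, (g x)%:C = z1 * char n x + z2 * char m x) -> multiplier g.
Proof.
move=> mg g1 gE; split => //; first by exists 1.
move=> f af; have := annihilatedD (annihilatedZ z1 (annihilatedM_char n af))
  (annihilatedZ z2 (annihilatedM_char m af)).
by apply: eq_annihilated => x _; rewrite gE; ring.
Qed.

Let unit_mode (i : 'I_d) : 'rV[int]_d := delta_mx ord0 i.

Let phase_unit_mode i x : phase w (unit_mode i) x = w ord0 i * tnth x i.
Proof.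
rewrite /phase (bigD1 i)//= big1 ?addr0 => [|j ji].
  by rewrite mxE !eqxx mulr1.
by rewrite mxE eqxx (negbTE ji)/= mulr0 mul0r.
Qed.

Let multiplier_cos i : multiplier (fun x => cos (w ord0 i * tnth x i)).
Proof.
apply: (@multiplier_char2 _ (2^-1)%:C (2^-1)%:C (unit_mode i) (- unit_mode i)).
- apply: (measurableT_comp (f := cos)); first exact: continuous_measurable_fun (@continuous_cos R).
  by apply: measurable_funM => //; exact: measurable_tnth.
- by move=> x; rewrite ler_norml cos_geN1 cos_le1.
- move=> x; rewrite !charE phaseN phase_unit_mode; apply: eq_ReIm.
  + by rewrite cReD !cReM /= cosN; lra.
  + by rewrite cImD !cImM /= sinN; lra.
Qed.

Let multiplier_sin i : multiplier (fun x => sin (w ord0 i * tnth x i)).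
Proof.
apply: (@multiplier_char2 _ (0 -i* 2^-1) (0 +i* 2^-1) (unit_mode i) (- unit_mode i)).
- apply: (measurableT_comp (f := sin)); first exact: continuous_measurable_fun (@continuous_sin R).
  by apply: measurable_funM => //; exact: measurable_tnth.
- by move=> x; rewrite ler_norml sin_geN1 sin_le1.
- move=> x; rewrite !charE phaseN phase_unit_mode; apply: eq_ReIm.
  + by rewrite cReD !cReM /= sinN; lra.
  + by rewrite cImD !cImM /= cosN; lra.
Qed.

Let multiplier_sin_abs i : multiplier (fun x => sin (`|w ord0 i| * tnth x i)).
Proof.
have [wp|wn] := ltP 0 (w ord0 i); first by rewrite gtr0_norm//; exact: multiplier_sin.
rewrite ler0_norm//; have := multiplierZ (-1) (multiplier_sin i); congr multiplier.
by apply/funext => x; rewrite mulN1r mulNr sinN.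
Qed.

Let multiplier_cos_abs i : multiplier (fun x => cos (`|w ord0 i| * tnth x i)).
Proof.
have [wp|wn] := ltP 0 (w ord0 i); first by rewrite gtr0_norm//; exact: multiplier_cos.
rewrite ler0_norm//; have := multiplier_cos i; congr multiplier.
by apply/funext => x; rewrite mulNr cosN.
Qed.

(** On the cell [|w_i| x_i] stays in [[0, 2 pi)]. According to the position of [c], the trace on the
    cell is empty, full, or an initial arc described by [le_arc_small] or [le_arc_large]. *)
Let S_half_space i (c : R) : S [set x | `|w ord0 i| * tnth x i <= c].
Proof.
pose y (x : T) := `|w ord0 i| * tnth x i.
have my : measurable_fun setT y.
  by apply: measurable_funM => //; exact: measurable_tnth.
have mA : measurable [set x | y x <= c].
  rewrite (_ : [set x | _] = setT `&` y @^-1` `]-oo, c]%classic).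
    by apply: my => //; exact: measurable_itv.
  by rewrite setTI; apply/seteqP; split => x /=; rewrite in_itv.
have w0 : 0 < `|w ord0 i| by rewrite normr_gt0.
have y02 x : cell x -> 0 <= y x < 2 * pi.
  move=> /(_ i)/andP[x0 x1]; rewrite /y mulr_ge0//=.
  by rewrite mulrC -ltr_pdivlMr.
have ext (B : set T) : (forall x, cell x -> (y x <= c) <-> B x) -> S B ->
    S [set x | y x <= c].
  by move=> yB; apply: S_ext => //; apply/seteqP; split => x /= [/yB h cx]; split => //; exact: h.
have S0 : S [set x | 0 <= sin (y x)] := S_ge0 (multiplier_sin_abs i).
have [c0|c0] := ltP c 0.
  apply: (ext set0); last by rewrite -setCT; exact: S_setC.
  by move=> x /y02/andP[yx _]; split => //; rewrite leNgt (lt_le_trans c0).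
have [cpi|cpi] := leP c pi.
  apply: (ext ([set x | 0 <= sin (y x)] `&` [set x | 0 <= cos (y x) - cos c])).
    move=> x /y02 yx; rewrite /= subr_ge0 (le_arc_small yx) ?c0//.
    by split=> [/andP|[-> ->]].
  apply: S_setI => //; apply: S_ge0.
  by apply: multiplierB; [exact: multiplier_cos_abs|exact: multiplier_cst].
have [c2|c2] := leP c (2 * pi).
  apply: (ext ([set x | 0 <= sin (y x)] `|` [set x | 0 <= cos c - cos (y x)])).
    move=> x /y02 yx; rewrite /= subr_ge0 (le_arc_large yx) ?c2 ?(ltW cpi)//.
    by split=> [/orP|[|] ->]; rewrite ?orbT.
  apply: S_setU => //; apply: S_ge0.
  by apply: multiplierB; [exact: multiplier_cst|exact: multiplier_cos_abs].
apply: (ext setT); last exact: S_setT.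
by move=> x /y02/andP[_ yx]; split => // _; rewrite (le_trans (ltW yx))// ltW.
Qed.

Let S_measurable (A : set T) : measurable A -> S A.
Proof.
have S0 : S set0 by rewrite -setCT; exact: S_setC.
have sS : sigma_algebra setT S.
  by split => // B sB; rewrite setTD; exact: S_setC.
have S_coord i (B : set (measurableTypeR R)) : measurable B -> S ((@tnth _ _ ^~ i) @^-1` B).
  move: B; suff : measurable `<=`
      [set B : set (measurableTypeR R) | S ((@tnth _ _ ^~ i) @^-1` B)] by [].
  apply: smallest_sub.
    split => [|B|F]; first by rewrite /= preimage_set0.
      by rewrite /= setTD preimage_setC; exact: S_setC.
    by rewrite /= preimage_bigcup; exact: S_bigcup.
  (* The Borel sets of the line are generated by the intervals []a, b]], differences of two
     half-lines. *)
  move=> _ [[a b] _ <-] /=.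
  have w0 : 0 < `|w ord0 i| by rewrite normr_gt0.
  rewrite (_ : _ @^-1` _ = [set x : T | `|w ord0 i| * tnth x i <= `|w ord0 i| * b] `&`
      ~` [set x : T | `|w ord0 i| * tnth x i <= `|w ord0 i| * a]).
    by apply: S_setI; [exact: S_half_space|apply: S_setC; exact: S_half_space].
  apply/funext => x; apply/propext; rewrite /= in_itv/= !ler_pM2l//.
  split=> [/andP[ax ->]|[-> /negP]]; last by rewrite -ltNge => ->.
  by split=> //; apply/negP; rewrite -ltNge.
(* The product sigma-algebra is generated by the preimages of Borel sets under the coordinates. *)
move: A; apply: smallest_sub => // B.
rewrite -bigcup_seq/= => -[i _ [C mC <-]]; rewrite setTI; exact: S_coord.
Qed.

(** Indicators of measurable sets are multipliers, so mode 0 of [f * \1_E] says that [f] has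
    integral zero over the part of every measurable [E] in the cell; both components then vanish
    almost everywhere. *)
Theorem annihilated_ae0 f : annihilated f -> f = (fun=> 0) %[ae mu in cell].
Proof.
move=> af; have [[ifr ifi] _] := af.
have key (E : set T) : measurable E -> cintegral mu cell (fun x => f x * (\1_E x)%:C) = 0.
  move=> /S_measurable[mE [_ _ /(_ _ af)[_ /(_ 0)]]] <-.
  by apply: eq_cintegral => x _; rewrite char0 mulr1.
have z (h : T -> R) : mu.-integrable cell (EFin \o h) ->
    (forall E, measurable E -> \int[mu]_(x in cell) (h x * \1_E x) = 0) ->
    ae_eq mu cell (EFin \o h) (fun=> 0%E).
  move=> ih h0; apply: integral_ae_eq => // E Ec mE.
  rewrite integral0; transitivity (\int[mu]_(x in cell `&` E) h x)%:E.
    rewrite /Rintegral setIidr// fineK//.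
    by apply: integrable_fin_num => //; exact: integrableS ih.
  congr EFin; rewrite Rintegral_mkcondr -[RHS](h0 E mE); apply: eq_Rintegral => x _.
  by rewrite patchE indicE; case: (x \in E); rewrite ?mulr1 ?mulr0.
have zr : ae_eq mu cell (fun x => (Re (f x))%:E) (fun=> 0%E).
  apply: z ifr _ => E mE; rewrite -[RHS](congr1 (@complex.Re R) (key E mE)).
  by apply: eq_Rintegral => x _; rewrite cReM /= mulr0 subr0.
have zi : ae_eq mu cell (fun x => (Im (f x))%:E) (fun=> 0%E).
  apply: z ifi _ => E mE; rewrite -[RHS](congr1 (@complex.Im R) (key E mE)).
  by apply: eq_Rintegral => x _; rewrite cImM /= mulr0 add0r.
apply: filterS2 zr zi => x zr zi cx; apply: eq_ReIm.
- by have [] := zr cx.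
- by have [] := zi cx.
Qed.

End fourier_uniqueness.

(** * Fourier series and the Wiener algebra *)

Section countable_sums.
Variable K : countType.

(** An increasing exhaustion of [K] by finite duplicate-free lists; limits along it realize the sums
    of absolutely summable families. *)
Definition cenum (N : nat) : seq K := pmap (@pickle_inv K) (iota 0 N).

Lemma mem_cenum N x : (x \in cenum N) = (pickle x < N)%N.
Proof.
rewrite /cenum mem_pmap; apply/mapP/idP => [[k]|xN].
  rewrite mem_iota add0n leq0n /= => kN e; have := @pickle_invK K k.
  by rewrite -e /= => ->.
by exists (pickle x); rewrite ?mem_iota// pickleK_inv.
Qed.

Lemma cenum_uniq N : uniq (cenum N).
Proof.
have key s : uniq s -> uniq (pmap (@pickle_inv K) s).
  elim: s => //= k s IH /andP[ks us].
  have := @pickle_invK K k; case E : (pickle_inv k) => [x|] /= xk; last exact: IH.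
  rewrite IH// andbT mem_pmap; apply/mapP => -[j js e].
  have := @pickle_invK K j; rewrite -e /= xk => kj.
  by rewrite kj js in ks.
exact/key/iota_uniq.
Qed.

Lemma cenumS N : cenum N.+1 = cenum N ++ seq_of_opt (@pickle_inv K N).
Proof. by rewrite /cenum -addn1 iotaD pmap_cat/= add0n; case: pickle_inv. Qed.

Lemma cenum_sup (s : seq K) : exists N0, forall N, (N0 <= N)%N -> {subset s <= cenum N}.
Proof.
exists (\max_(x <- s) (pickle x).+1) => N sN x xs; rewrite mem_cenum.
by apply: leq_trans sN; rewrite (big_rem x)//= leq_maxl.
Qed.

Lemma big_uniq_subset (V : zmodType) (s t : seq K) (F : K -> V) :
  uniq s -> uniq t -> {subset t <= s} ->
  (forall x, x \notin t -> F x = 0) -> \sum_(x <- s) F x = \sum_(x <- t) F x.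
Proof.
move=> us ut ts F0; rewrite (bigID (mem t))/= [X in _ + X]big1 ?addr0//.
rewrite -big_filter; apply: perm_big; apply: uniq_perm; rewrite ?filter_uniq// => x.
by rewrite mem_filter; case: (boolP (x \in t)) => //= /ts ->.
Qed.

Variable R : realType.
Implicit Types a b : K -> R.

(* For [a >= 0]: the sum of the family [a] is at most [M]. *)
Definition absum a (M : R) : Prop := forall s : seq K, uniq s -> \sum_(x <- s) a x <= M.

Lemma absum_ge0 a M : absum a M -> 0 <= M.
Proof. by move=> /(_ [::] isT); rewrite big_nil. Qed.

Lemma absum_le a b M : (forall x, a x <= b x) -> absum b M -> absum a M.
Proof. by move=> ab bM s us; apply: le_trans (bM s us); apply: ler_sum. Qed.

Lemma absum_esum a M : (forall x, 0 <= a x) ->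
  absum a M <-> (\esum_(x in [set: K]) (a x)%:E <= M%:E)%E.
Proof.
move=> a0; split=> [aM|].
  apply: ge_ereal_sup => _ [X [fX _] <-].
  rewrite fsbig_finite//= sumEFin lee_fin; exact/aM/finmap.fset_uniq.
move=> aM s us; rewrite -lee_fin; apply: le_trans aM; rewrite -sumEFin.
apply: esum_ge; exists [set` s]; first by split => //; exact: finite_seq.
rewrite fsbig_finite//=.
rewrite le_eqVlt; apply/orP; left; apply/eqP; apply: perm_big.
apply: uniq_perm => //; first exact: finmap.fset_uniq.
by move=> x; rewrite in_fset_set ?mem_setE//; exact: finite_seq.
Qed.

(** Take a finite list whose sum is within [e] of the supremum of all finite sums: a list disjoint
    from it cannot contribute more than [e]. *)
Lemma absum_tail a M : (forall x, 0 <= a x) -> absum a M -> forall e, 0 < e ->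
  exists N, forall s, uniq s -> (forall x, x \in s -> x \notin cenum N) ->
  \sum_(x <- s) a x <= e.
Proof.
move=> a0 aM e e0.
pose V := [set \sum_(x <- s) a x | s in [set s : seq K | uniq s]].
have hV : has_sup V.
  split; first by exists (\sum_(x <- [::]) a x); exists [::].
  by exists M => _ [s us <-]; exact: aM.
have [_ [s0 us0 <-] hs0] := sup_adherent e0 hV.
have [N hN] := cenum_sup s0; exists N => s us sN.
have : \sum_(x <- s ++ s0) a x <= sup V.
  apply: sup_upper_bound => //; exists (s ++ s0) => //=.
  rewrite cat_uniq us us0 andbT/=; apply/hasPn => x xs0.
  by apply/negP => /sN; rewrite (hN N).
rewrite big_cat/=; lra.
Qed.

(* Meaningful only for absolutely summable [c]; otherwise the limits may be junk. *)
Definition csum (c : K -> R[i]) : R[i] :=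
  limn (fun N => Re (\sum_(x <- cenum N) c x)) +i* limn (fun N => Im (\sum_(x <- cenum N) c x)).

Let is_cvg_sum a b M : (forall x, `|a x| <= b x) -> absum b M ->
  cvgn (fun N => \sum_(x <- cenum N) a x).
Proof.
move=> ab bM.
(* Numbers that code no element of [K] contribute 0, which turns the sums along [cenum] into an
   ordinary series. *)
pose g (f : K -> R) (i : nat) : R := oapp f 0 (pickle_inv i).
have gE f : (fun N => \sum_(x <- cenum N) f x) = series (g f).
  apply/funext; elim=> [|N IH].
    by rewrite /series /= big_nil big_geq.
  rewrite cenumS big_cat /= IH /series /= big_nat_recr//=; congr (_ + _).
  by rewrite /g; case: pickle_inv => [x|] /=; rewrite ?big_seq1 ?big_nil.
have b0 x : 0 <= b x by exact: le_trans (normr_ge0 _) (ab x).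
have cvb : cvgn (series (g b)).
  rewrite -gE; apply: nondecreasing_is_cvgn.
    apply/nondecreasing_seqP => N; rewrite cenumS big_cat/= lerDl.
    by apply: sumr_ge0.
  by exists M => _ [N _ <-]; apply: bM; exact: cenum_uniq.
rewrite gE; apply: normed_cvg; apply: series_le_cvg cvb => i.
- exact: normr_ge0.
- by rewrite /g; case: pickle_inv => /=.
- by rewrite /= /g; case: pickle_inv => [x|] /=; rewrite ?normr0.
Qed.

Lemma ccvg_csum c M : absum (fun x => normc (c x)) M ->
  ccvg \oo (fun N => \sum_(x <- cenum N) c x) (csum c).
Proof.
move=> cM; split => /=.
- have := @is_cvg_sum (fun x => Re (c x)) _ M (fun x => normc_ge_absRe (c x)) cM.
  by under eq_fun do rewrite -cRe_sum.
- have := @is_cvg_sum (fun x => Im (c x)) _ M (fun x => normc_ge_absIm (c x)) cM.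
  by under eq_fun do rewrite -cIm_sum.
Qed.

Lemma normc_csum c M : absum (fun x => normc (c x)) M -> normc (csum c) <= M.
Proof.
move=> cM; have /ccvg_normc h := ccvg_csum cM.
rewrite -(cvg_lim _ h)//; apply: limr_le; first exact: cvgP h.
by apply: nearW => N; rewrite (le_trans (normc_sum _ _))//; exact/cM/cenum_uniq.
Qed.

End countable_sums.

Section fourier_coefficients.
Variables (R : realType) (d : nat) (w : 'rV[R]_d).
Hypothesis hw : forall i, w ord0 i != 0.
Local Notation mu := (lebesgue_tuple R d).
Local Notation cell := (cell w : set (d.-tuple (measurableTypeR R))).
Local Notation char := (char w).
Local Notation fourier := (fourier w).
Local Notation T := (d.-tuple (measurableTypeR R)).
Local Notation Zd := ('rV[int]_d).
Implicit Types (n m : Zd) (u v : d.-tuple R -> R[i]) (c : Zd -> R[i]).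

Let mcell := measurable_cell w.
Lemma torus_aeqS u v u' v' : (forall x, u x = v x -> u' x = v' x) ->
  torus_aeq w u v -> torus_aeq w u' v'.
Proof.
move=> h; apply: filterS; first exact: (ae_filter_ringOfSetsType mu).
by move=> x /[swap] cx /(_ cx); exact: h.
Qed.

Lemma fourierE u n :
  fourier u n = ((volume w)^-1)%:C * cintegral mu cell (fun x => u x * char (- n) x).
Proof.
rewrite /Defs.fourier cell_volume//; congr (_ * _).
by apply: eq_cintegral => x _; rewrite cis_oppE.
Qed.

Lemma fourierD u v n : cintegrable mu cell u -> cintegrable mu cell v ->
  fourier (fun x => u x + v x) n = fourier u n + fourier v n.
Proof.
move=> iu iv; rewrite !fourierE -mulrDr -cintegralD//; try exact: cintegrableM_char.
by congr (_ * _); apply: eq_cintegral => x _; rewrite mulrDl.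
Qed.

Lemma fourierB u v n : cintegrable mu cell u -> cintegrable mu cell v ->
  fourier (fun x => u x - v x) n = fourier u n - fourier v n.
Proof.
move=> iu iv; rewrite !fourierE -mulrBr -cintegralB//; try exact: cintegrableM_char.
by congr (_ * _); apply: eq_cintegral => x _; rewrite mulrBl.
Qed.

Lemma ae_eq_fourier u v n : cmeasurable cell u -> cmeasurable cell v ->
  torus_aeq w u v -> fourier u n = fourier v n.
Proof.
move=> mu_ mv uv; rewrite !fourierE; congr (_ * _); apply: ae_eq_cintegral => //.
- by apply: cmeasurableM => //; exact: cmeasurable_char.
- by apply: cmeasurableM => //; exact: cmeasurable_char.
- by apply: torus_aeqS uv => x ->.
Qed.

Lemma fourier_char m n : fourier (char m) n = (n == m)%:R.
Proof.
have e : cintegral mu cell (fun x => char m x * char (- n) x) = cintegral mu cell (char (m - n)).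
  by apply: eq_cintegral => x _; rewrite charD.
rewrite fourierE e cintegral_char// subr_eq0 eq_sym; case: (n == m); rewrite ?mulr0//.
by rewrite -rmorphM mulVf// gt_eqF ?volume_gt0.
Qed.

Lemma fourier1 n : fourier (fun=> 1) n = (n == 0)%:R.
Proof.
have -> : (fun=> 1) = char 0 by apply/funext => x; rewrite char0.
exact: fourier_char.
Qed.

Lemma fourier_inj u v : cintegrable mu cell u -> cintegrable mu cell v ->
  (forall n, fourier u n = fourier v n) -> torus_aeq w u v.
Proof.
move=> iu iv uv.
have : annihilated w (fun x => u x - v x).
  split; first exact: cintegrableB.
  move=> n; have /eqP := fourierB (- n) iu iv; rewrite uv subrr fourierE opprK.
  rewrite mulf_eq0 => /orP[/eqP[] /eqP|/eqP//].
  by rewrite invr_eq0 gt_eqF// volume_gt0.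
move/(annihilated_ae0 hw); apply: torus_aeqS => x /eqP.
by rewrite subr_eq0 => /eqP.
Qed.

Definition synth c (x : d.-tuple R) : R[i] := csum (fun n => c n * char n x).

Section synthesis.
Variables (c : Zd -> R[i]) (M : R).
Hypothesis cM : absum (fun n => normc (c n)) M.

Let cxM x : absum (fun n => normc (c n * char n x)) M.
Proof.
by under eq_fun do rewrite ComplexField.Normc.normcM normc_char mulr1.
Qed.

Lemma ccvg_synth x : ccvg \oo (fun N => \sum_(n <- cenum _ N) c n * char n x) (synth c x).
Proof. exact: ccvg_csum (cxM x). Qed.

Lemma normc_partial_sum N x : normc (\sum_(n <- cenum _ N) c n * char n x) <= M.
Proof. by rewrite (le_trans (normc_sum _ _))//; exact/cxM/cenum_uniq. Qed.

Lemma normc_synth x : normc (synth c x) <= M.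
Proof. exact: normc_csum (cxM x). Qed.

Lemma cmeasurable_synth (D : set T) : cmeasurable D (synth c).
Proof.
apply: (@cmeasurable_ccvg _ _ _ _ (fun N x => \sum_(n <- cenum _ N) c n * char n x)).
- move=> N; apply: cmeasurable_sum => n; apply: cmeasurableM.
    exact: cmeasurable_cst.
  exact: cmeasurable_char.
- by move=> x _; exact: ccvg_synth.
Qed.

Lemma cintegrable_synth : cintegrable mu cell (synth c).
Proof.
apply: (@cintegrable_bounded _ _ _ _ _ mcell _ M).
- exact: cell_lty.
- exact: cmeasurable_synth.
- by move=> x _; exact: normc_synth.
Qed.

Lemma synth_periodic : Defs.periodic w (synth c).
Proof.
move=> m x; rewrite /synth; congr csum; apply/funext => n.
by rewrite char_periodic.
Qed.

(** Dominated convergence with only one factor expanded: the partial sums of [synth c] are bounded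
    by [M], and [v] is merely integrable. The choice [v = 1] yields the coefficients of [synth c]; a
    [v] in the Wiener algebra yields the convolution formula. *)
Lemma ccvg_fourier_synthM v n : cintegrable mu cell v ->
  ccvg \oo (fun N => \sum_(m <- cenum _ N) c m * fourier v (n - m))
    (fourier (fun x => synth c x * v x) n).
Proof.
move=> iv; rewrite fourierE.
pose f N x := (\sum_(m <- cenum _ N) c m * char m x) * v x * char (- n) x.
have mf N : cmeasurable cell (f N).
  apply: cmeasurableM; last exact: cmeasurable_char.
  apply: cmeasurableM; last exact: cintegrable_measurable iv.
  apply: cmeasurable_sum => m; apply: cmeasurableM; last exact: cmeasurable_char.
  exact: cmeasurable_cst.
have [||||_ cv] := @cdominated _ _ _ mu _ mcell f
    (fun x => synth c x * v x * char (- n) x) (fun x => M * (`|Re (v x)| + `|Im (v x)|)).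
- exact: mf.
- move=> x _; apply: ccvgM; last exact: ccvg_cst.
  by apply: ccvgM; [exact: ccvg_synth|exact: ccvg_cst].
- have iN : mu.-integrable cell (fun x => (`|(Re (v x))%:E| + `|(Im (v x))%:E|)%E).
    by apply: integrableD => //; apply: integrable_abse; case: iv.
  by have := integrableZl mcell M iN; apply: eq_integrable.
- move=> N x _; rewrite !ComplexField.Normc.normcM normc_char mulr1.
  by rewrite ler_pM ?normc_ge0// ?normc_le_ReIm// normc_partial_sum.
rewrite (_ : (fun N => _) = fun N => ((volume w)^-1)%:C * cintegral mu cell (f N)).
  by apply: ccvgM => //; exact: ccvg_cst.
apply/funext => N.
have -> : cintegral mu cell (f N) = cintegral mu cell
    (fun x => \sum_(m <- cenum _ N) c m * (v x * char (- (n - m)) x)).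
  apply: eq_cintegral => x _; rewrite /f !mulr_suml; apply: eq_bigr => m _.
  by rewrite opprB charD; ring.
rewrite (cintegral_sum mcell) => [|m].
  rewrite mulr_sumr; apply: eq_bigr => m _.
  by rewrite (cintegralZ mcell) ?fourierE 1?mulrCA//; exact: cintegrableM_char.
by apply: (cintegrableZ mcell); exact: cintegrableM_char.
Qed.

Lemma fourier_synth n : fourier (synth c) n = c n.
Proof.
have i1 : cintegrable mu cell (fun=> 1).
  by have := cintegrable_char hw 0; apply: eq_cintegrable => // x _; rewrite char0.
have := ccvg_fourier_synthM n i1.
rewrite (_ : (fun x => synth c x * 1) = synth c); last by apply/funext => x; rewrite mulr1.
move=> h; apply: ccvg_unique h _; apply/ccvg_normcP.
apply: cvg_near_cst; exists (pickle n).+1 => // N /= nN.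
rewrite (@big_uniq_subset _ _ _ [:: n]).
- by rewrite big_seq1 subrr fourier1 eqxx mulr1 subrr ComplexField.Normc.normc0.
- exact: cenum_uniq.
- by [].
- by move=> m; rewrite inE => /eqP ->; rewrite mem_cenum.
- by move=> m; rewrite inE => mn; rewrite fourier1 subr_eq0 eq_sym (negbTE mn) mulr0.
Qed.

End synthesis.

(** The unweighted Wiener norm, phrased as a bound so that no supremum is handled. Products and the
    comparison of solutions are estimated in it; [wbound_wnorm] derives it from the weighted
    norm. *)
Definition wbound u (M : R) : Prop :=
  cintegrable mu cell u /\ absum (fun n => normc (fourier u n)) M.

Lemma wbound_synth u M : wbound u M -> torus_aeq w u (synth (fourier u)).
Proof.
move=> [iu uM]; apply: fourier_inj => //; first exact: cintegrable_synth uM.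
by move=> n; rewrite (fourier_synth uM).
Qed.

(** A product of two integrable functions need not be integrable. Here [u] agrees almost everywhere
    with its Fourier series, which is bounded by [M], so that series can replace [u]. *)
Lemma wboundM_ae u v M N : wbound u M -> wbound v N ->
  cintegrable mu cell (fun x => u x * v x) /\
  forall n, fourier (fun x => u x * v x) n = fourier (fun x => synth (fourier u) x * v x) n.
Proof.
move=> uM [iv vN]; have [iu uM'] := uM; have uE := wbound_synth uM.
have muv : cmeasurable cell (fun x => u x * v x).
  by apply: cmeasurableM; [exact: cintegrable_measurable iu|exact: cintegrable_measurable iv].
have iuv : cintegrable mu cell (fun x => synth (fourier u) x * v x).
  have := @cintegrableM_bounded _ _ _ _ _ mcell _ _ M iv
    (cmeasurable_synth uM' cell) (fun x _ => normc_synth uM' x).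
  by under eq_fun do rewrite mulrC.
have e : (fun x => u x * v x) = (fun x => synth (fourier u) x * v x) %[ae mu in cell].
  by apply: torus_aeqS uE => x ->.
split; first exact: ae_eq_cintegrable e iuv.
by move=> n; apply: ae_eq_fourier => //; exact: cintegrable_measurable iuv.
Qed.

Lemma ccvg_fourierM u v M N n : wbound u M -> wbound v N ->
  ccvg \oo (fun k => \sum_(m <- cenum _ k) fourier u m * fourier v (n - m))
    (fourier (fun x => u x * v x) n).
Proof.
move=> uM vN; rewrite (wboundM_ae uM vN).2.
by apply: ccvg_fourier_synthM; [exact: uM.2|exact: vN.1].
Qed.

(** Young's inequality in [l^1]: it holds for truncated convolutions tested on finite lists, by
    exchanging the sums and translating the list by [m], and passes to the limit. *)
Lemma wboundM u v M N : wbound u M -> wbound v N -> wbound (fun x => u x * v x) (M * N).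
Proof.
move=> uM vN; split; first exact: (wboundM_ae uM vN).1.
move=> s us.
have h : (\sum_(n <- s) normc (\sum_(m <- cenum _ k) fourier u m * fourier v (n - m)))
    @[k --> \oo] --> \sum_(n <- s) normc (fourier (fun x => u x * v x) n).
  by apply: cvg_sum_seq => n; apply: ccvg_normc; exact: ccvg_fourierM uM vN.
rewrite -(cvg_lim _ h)//; apply: limr_le; first exact: cvgP h.
apply: nearW => k.
apply: (@le_trans _ _ (\sum_(n <- s) \sum_(m <- cenum _ k)
    normc (fourier u m) * normc (fourier v (n - m)))).
  apply: ler_sum => n _; rewrite (le_trans (normc_sum _ _))//.
  by apply: ler_sum => m _; rewrite ComplexField.Normc.normcM.
rewrite exchange_big /=.
apply: (@le_trans _ _ (\sum_(m <- cenum _ k) normc (fourier u m) * N)).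
  apply: ler_sum => m _; rewrite -mulr_sumr ler_wpM2l ?normc_ge0//.
  rewrite -(big_map (fun n => n - m) xpredT (fun n => normc (fourier v n))).
  by apply: vN.2; rewrite map_inj_uniq// => x y /addIr.
rewrite -mulr_suml ler_wpM2r//; first exact: absum_ge0 vN.2.
exact/uM.2/cenum_uniq.
Qed.

Lemma wboundD u v M N : wbound u M -> wbound v N -> wbound (fun x => u x + v x) (M + N).
Proof.
move=> [iu uM] [iv vN]; split; first exact: cintegrableD.
move=> s us; apply: le_trans (lerD (uM s us) (vN s us)); rewrite -big_split.
by apply: ler_sum => n _; rewrite fourierD// normcD_le.
Qed.

Lemma wbound1 : wbound (fun=> 1) 1.
Proof.
split.
  by have := cintegrable_char hw 0; apply: eq_cintegrable => // x _; rewrite char0.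
move=> s us; apply: (@le_trans _ _ (\sum_(n <- s) (n == 0)%:R)).
  apply: ler_sum => n _; rewrite fourier1; case: (n == 0).
    by rewrite ComplexField.Normc.normc1.
  by rewrite ComplexField.Normc.normc0.
rewrite -natr_sum lern1 -big_mkcond /= sum1_count.
have : perm_eq (undup s) s by rewrite undup_id.
by rewrite (eq_count (a2 := pred1 0))// count_uniq_mem//; case: (_ \in _).
Qed.

End fourier_coefficients.

Section ereal_limits.
Variable R : realType.

Lemma cvg_ereal0P (T : Type) (F : set_system T) (FF : Filter F) (f : T -> \bar R) :
  (forall x, (0 <= f x)%E) ->
  (f x @[x --> F] --> 0%E) <-> (forall e, 0 < e -> \forall x \near F, (f x <= e%:E)%E).
Proof.
move=> f0; split=> [/fine_cvgP[ff /cvgrPdist_le cf] e e0|h].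
  near=> x; have fx : f x \is a fin_num by near: x.
  rewrite -(fineK fx) lee_fin.
  suff : `|0 - fine (f x)| <= e by rewrite sub0r normrN ger0_norm ?fine_ge0.
  by near: x; exact: cf.
apply/fine_cvgP; split.
  near=> x; rewrite ge0_fin_numE// (@le_lt_trans _ _ 1%:E) ?ltry//.
  by near: x; exact: h.
apply/cvgrPdist_le => e e0; near=> x.
have fe : (f x <= e%:E)%E by near: x; exact: h.
have fx : f x \is a fin_num by rewrite ge0_fin_numE// (le_lt_trans fe) ?ltry.
by rewrite sub0r normrN ger0_norm ?fine_ge0// -lee_fin fineK.
Unshelve. all: by end_near. Qed.

End ereal_limits.

(** * The weighted norm *)

Section weighted_norm.
Variables (R : realType) (d : nat) (w : 'rV[R]_d).
Hypothesis hw : forall i, w ord0 i != 0.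
Variable s : R.
Hypothesis hs : 0 <= s.
Local Notation mu := (lebesgue_tuple R d).
Local Notation cell := (cell w : set (d.-tuple (measurableTypeR R))).
Local Notation fourier := (fourier w).
Local Notation Zd := ('rV[int]_d).
Implicit Types (n m : Zd) (u v : d.-tuple R -> R[i]).

Definition weight n : R := (1 + (norm1 n)%:R) `^ s.

Lemma weight_ge1 n : 1 <= weight n.
Proof.
have /(congr1 (@^~ s)) /= <- := powR1 R; apply: ge0_ler_powR => //.
- by rewrite nnegrE.
- by rewrite nnegrE addr_ge0.
- by rewrite lerDl.
Qed.

Lemma weight_ge0 n : 0 <= weight n. Proof. exact: powR_ge0. Qed.

(** Rests on [1 + |n + m| <= (1 + |n|) (1 + |m|)]; submultiplicativity is what lets the weighted
    norm pass through products. *)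
Lemma weightD n m : weight (n + m) <= weight n * weight m.
Proof.
rewrite /weight -powRM ?addr_ge0//; apply: ge0_ler_powR => //.
- by rewrite nnegrE addr_ge0.
- by rewrite nnegrE mulr_ge0// addr_ge0.
- have : ((norm1 (n + m))%:R <= (norm1 n)%:R + (norm1 m)%:R :> R).
    rewrite -natrD ler_nat /norm1 -big_split; apply: leq_sum => i _ /=.
    by rewrite mxE -lez_nat PoszD !abszE ler_normD.
  have := ler0n R (norm1 n); have := ler0n R (norm1 m); nra.
Qed.

Lemma wnorm_ge0 u : (0 <= wnorm w s u)%E.
Proof. by apply: esum_ge0 => n _; rewrite lee_fin mulr_ge0 ?powR_ge0 ?normc_ge0. Qed.

Lemma wnorm_leP u M :
  (wnorm w s u <= M%:E)%E <-> absum (fun n => weight n * normc (fourier u n)) M.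
Proof.
by split=> /absum_esum; apply => n; rewrite mulr_ge0 ?powR_ge0 ?normc_ge0.
Qed.

Lemma wbound_wnorm u M : cintegrable mu cell u -> (wnorm w s u <= M%:E)%E -> wbound w u M.
Proof.
move=> iu /wnorm_leP uM; split => //; apply: absum_le uM => n.
by rewrite ler_peMl ?normc_ge0// weight_ge1.
Qed.

Lemma wnorm_fin u : (wnorm w s u < +oo)%E -> wnorm w s u = (fine (wnorm w s u))%:E.
Proof. by move=> h; rewrite fineK// ge0_fin_numE// wnorm_ge0. Qed.

Lemma wnorm_synth (c : Zd -> R[i]) M :
  absum (fun n => weight n * normc (c n)) M ->
  [/\ wiener w s (synth w c), forall n, fourier (synth w c) n = c n &
      (wnorm w s (synth w c) <= M%:E)%E].
Proof.
move=> cM; have cM1 : absum (fun n => normc (c n)) M.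
  by apply: absum_le cM => n; rewrite ler_peMl ?normc_ge0// weight_ge1.
have fc n := fourier_synth hw cM1 n.
have le : (wnorm w s (synth w c) <= M%:E)%E.
  by apply/wnorm_leP; under eq_fun do rewrite fc.
split => //; split; last exact: le_lt_trans le (ltry _).
by split; [exact: synth_periodic|exact: cintegrable_synth cM1].
Qed.

(** Dominated convergence for series: outside a finite set of modes the majorant leaves little mass
    whatever [th] is, and on that set coefficientwise continuity suffices. *)
Lemma wcontinuous_synth (X : topologicalType) (c : X -> Zd -> R[i]) (b : Zd -> R) (M : R) :
  (forall th n, normc (c th n) <= b n) -> absum (fun n => weight n * b n) M ->
  (forall n th, ccvg (nbhs th) (c^~ n) (c th n)) ->
  wcontinuous w s setT (fun th => synth w (c th)).
Proof.
move=> cb bM cc th _; have b0 n : 0 <= b n by exact: le_trans (normc_ge0 _) (cb th n).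
have wb0 n : 0 <= weight n * b n by rewrite mulr_ge0 ?weight_ge0.
have cM th' : absum (fun n => weight n * normc (c th' n)) M.
  by apply: absum_le bM => n; rewrite ler_wpM2l ?weight_ge0.
have cM1 th' : absum (fun n => normc (c th' n)) M.
  by apply: absum_le (cM th') => n; rewrite ler_peMl ?normc_ge0// weight_ge1.
apply/cvg_ereal0P => [y|e e0]; first exact: wnorm_ge0.
(* A quarter, because the difference of two coefficients is dominated by [2 * b n]: the tail then
   costs [e / 2]. *)
have e4 : 0 < e / 4 by rewrite divr_gt0.
have [N tailN] := absum_tail wb0 bM e4.
have : \sum_(n <- cenum _ N) weight n * normc (c y n - c th n) @[y --> nbhs th] --> (0 : R).
  rewrite [X in _ --> X](_ : 0 = \sum_(n <- cenum _ N) weight n * 0); last first.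
    by rewrite big1// => n _; rewrite mulr0.
  apply: cvg_sum_seq => n; apply: cvgM; first exact: cvg_cst.
  by have /ccvg_normcP := cc n th.
move=> /cvgrPdist_le/(_ (e / 2)); rewrite divr_gt0// => /(_ isT) hnear.
apply: filterS hnear => y hy0 _.
have hy : \sum_(n <- cenum _ N) weight n * normc (c y n - c th n) <= e / 2.
  move: hy0.
  rewrite sub0r normrN ger0_norm// sumr_ge0// => n _.
  by rewrite mulr_ge0 ?weight_ge0 ?normc_ge0.
apply/wnorm_leP => r ur.
have fE n : fourier (fun z => synth w (c y) z - synth w (c th) z) n = c y n - c th n.
  by rewrite fourierB ?(fourier_synth hw (cM1 _))//; exact: cintegrable_synth (cM1 _).
under eq_bigr do rewrite fE.
rewrite (bigID (fun n => n \in cenum _ N))/=.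
have h1 : \sum_(n <- r | n \in cenum _ N) weight n * normc (c y n - c th n) <= e / 2.
  apply: le_trans hy; rewrite -big_filter.
  rewrite [leRHS](bigID (fun n => n \in r))/= -[X in _ <= X + _]big_filter.
  rewrite (perm_big [seq n <- cenum _ N | n \in r])/=.
    by rewrite lerDl sumr_ge0// => n _; rewrite mulr_ge0 ?weight_ge0 ?normc_ge0.
  apply: uniq_perm; rewrite ?filter_uniq// ?cenum_uniq// => n.
  by rewrite !mem_filter andbC.
have h2 : \sum_(n <- r | n \notin cenum _ N) weight n * normc (c y n - c th n) <= e / 2.
  apply: (@le_trans _ _ (\sum_(n <- [seq n <- r | n \notin cenum _ N]) 2 * (weight n * b n))).
    rewrite -big_filter; apply: ler_sum => n _.
    rewrite mulrCA ler_wpM2l ?weight_ge0//.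
    by rewrite (le_trans (normcD_le _ _))// normc_opp mulr_natl mulr2n lerD.
  rewrite -mulr_sumr; have := tailN [seq n <- r | n \notin cenum _ N].
  rewrite filter_uniq// => /(_ isT) h.
  have : \sum_(x <- [seq n <- r | n \notin cenum _ N]) weight x * b x <= e / 4.
    by apply: h => x; rewrite mem_filter => /andP[].
  lra.
lra.
Qed.

End weighted_norm.

(** * The recursive solution *)

Section integer_boxes.
Variable d : nat.
Local Notation Zd := ('rV[int]_d).
Implicit Types m n : Zd.

(** The modes that can occur in a convolution at [n] of families supported on nonnegative modes;
    empty as soon as [n] has a negative entry. As [norm1 n] bounds every entry, the range to be
    filtered is finite. *)
Definition zbox n : seq Zd := [seq m : Zd <- [seq \row_i (f i : nat)%:Z |
  f : {ffun 'I_d -> 'I_(norm1 n).+1} <- enum predT] | [forall i, m ord0 i <= n ord0 i]].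

Lemma zboxP m n : reflect (forall i, 0 <= m ord0 i <= n ord0 i) (m \in zbox n).
Proof.
apply: (iffP idP) => [|h].
  rewrite mem_filter => /andP[/forallP mn /mapP[f _ mE]] i.
  by rewrite mn andbT mE mxE.
rewrite mem_filter; apply/andP; split.
  by apply/forallP => i; case/andP: (h i).
have lt i : (`|m ord0 i|%N < (norm1 n).+1)%N.
  rewrite ltnS; apply: (@leq_trans `|n ord0 i|%N); first by have := h i; lia.
  by rewrite /norm1 (bigD1 i)//= leq_addr.
apply/mapP; exists [ffun i => Ordinal (lt i)]; first by rewrite mem_enum.
by apply/rowP => i; rewrite mxE ffunE /= gez0_abs//; case/andP: (h i).
Qed.

Lemma zbox_uniq n : uniq (zbox n).
Proof.
apply: filter_uniq; rewrite map_inj_uniq ?enum_uniq// => f g /rowP fg.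
by apply/ffunP => i; have := fg i; rewrite !mxE => -[] /val_inj.
Qed.

(** Nothing cancels inside the box, so sizes add; both indices of a convolution term thus have size
    at most [norm1 n], and the recursion descends on this size. *)
Lemma norm1B m n : m \in zbox n -> norm1 n = (norm1 m + norm1 (n - m))%N.
Proof.
move=> /zboxP h; rewrite /norm1 -big_split; apply: eq_bigr => i _ /=.
by have := h i; rewrite !mxE; move: (m ord0 i) (n ord0 i) => a b; lia.
Qed.

Definition positive n := [forall i, 1 <= n ord0 i].

Lemma positive_norm1 n : (1 <= d)%N -> positive n -> (0 < norm1 n)%N.
Proof.
move=> d0 /forallP/(_ (Ordinal d0)) n0.
by rewrite /norm1 (bigD1 (Ordinal d0))//= addn_gt0; move: n0; lia.
Qed.

End integer_boxes.

(** * Exponential sums on the torus of angles *)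

Section exponential_sums.
Variables (R : realType) (d : nat).
Local Notation Zd := ('rV[int]_d).
Implicit Types (m n k : Zd) (th : 'rV[R]_d).

(* A list of pairs [(c, k)] stands for the exponential sum of the terms
   [c * cis (angle k th)]; repeated frequencies [k] are not merged. *)
Definition expsum : Type := seq (R[i] * Zd).
Implicit Types P Q : expsum.

Definition angle k th : R := \sum_i (k ord0 i)%:~R * th ord0 i.

Definition feval th P : R[i] := \sum_(e <- P) e.1 * cis (angle e.2 th).

Definition fnorm P : R := \sum_(e <- P) normc e.1.

Definition fmul P Q : expsum := [seq (e.1 * f.1, e.2 + f.2) | e <- P, f <- Q].

Lemma angleD k m th : angle (k + m) th = angle k th + angle m th.
Proof.
by rewrite /angle -big_split; apply: eq_bigr => i _ /=; rewrite mxE rmorphD mulrDl.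
Qed.

Lemma fnorm_ge0 P : 0 <= fnorm P.
Proof. by apply: sumr_ge0 => e _; exact: normc_ge0. Qed.

Lemma normc_feval th P : normc (feval th P) <= fnorm P.
Proof.
rewrite (le_trans (normc_sum _ _))//; apply: ler_sum => e _.
by rewrite ComplexField.Normc.normcM normc_cis mulr1.
Qed.

Lemma fmul_nil P : fmul P [::] = [::].
Proof. by rewrite /fmul; elim: P. Qed.

Lemma feval_fmul th P Q : feval th (fmul P Q) = feval th P * feval th Q.
Proof.
rewrite /feval /fmul big_allpairs_dep mulr_suml; apply: eq_bigr => e _.
rewrite mulr_sumr; apply: eq_bigr => f _ /=.
by rewrite angleD cisD; ring.
Qed.

Lemma fnorm_fmul P Q : fnorm (fmul P Q) = fnorm P * fnorm Q.
Proof.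
rewrite /fnorm /fmul big_allpairs_dep mulr_suml; apply: eq_bigr => e _.
by rewrite mulr_sumr; apply: eq_bigr => f _; rewrite ComplexField.Normc.normcM.
Qed.

Lemma feval_flatten th (I : Type) (r : seq I) (F : I -> expsum) :
  feval th (flatten [seq F i | i <- r]) = \sum_(i <- r) feval th (F i).
Proof. by rewrite /feval big_flatten big_map. Qed.

Lemma fnorm_flatten (I : Type) (r : seq I) (F : I -> expsum) :
  fnorm (flatten [seq F i | i <- r]) = \sum_(i <- r) fnorm (F i).
Proof. by rewrite /fnorm big_flatten big_map. Qed.

Lemma feval_periodic P (m : Zd) th :
  feval (th + \row_i (2 * pi * (m ord0 i)%:~R)) P = feval th P.
Proof.
apply: eq_bigr => e _; congr (_ * _).
have -> : angle e.2 (th + \row_i (2 * pi * (m ord0 i)%:~R)) =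
    angle e.2 th + 2 * pi * (\sum_i e.2 ord0 i * m ord0 i)%:~R.
  rewrite rmorph_sum mulr_sumr /angle -big_split; apply: eq_bigr => i _ /=.
  by rewrite !mxE rmorphM /=; ring.
by rewrite cisD cis_2pi_int mulr1.
Qed.

Lemma ccvg_feval P th : ccvg (nbhs th) (feval^~ P) (feval th P).
Proof.
apply: ccvg_sum => e; apply: ccvgM; first exact: ccvg_cst.
have ca : angle e.2 y @[y --> th] --> angle e.2 th.
  apply: (cvg_sum_seq (nbhs_filter th)) => i; apply: cvgM; first exact: cvg_cst.
  exact: coord_continuous.
split => /=.
- by apply: (cvg_comp _ _ ca); exact: continuous_cos.
- by apply: (cvg_comp _ _ ca); exact: continuous_sin.
Qed.

Definition fconv (A B : Zd -> expsum) n : expsum :=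
  flatten [seq fmul (A m) (B (n - m)) | m <- zbox n].

Fixpoint fpow (A : Zd -> expsum) (q : nat) n : expsum :=
  if q is q'.+1 then fconv A (fpow A q') n else if n == 0 then [:: (1, 0)] else [::].

Lemma mem_fconv (A B : Zd -> expsum) n e : e \in fconv A B n ->
  exists m f g, [/\ m \in zbox n, f \in A m, g \in B (n - m) & e.2 = f.2 + g.2].
Proof.
move=> /flattenP[_ /mapP[m mn ->]] /allpairsP[[f g] /= [fA gB ->]].
by exists m, f, g.
Qed.

(** The sums over boxes are enlarged to the common finite list [K], which only adds nonnegative
    terms; the two sums can then be exchanged, and for fixed [m] the other one runs over translated
    indices. *)
Lemma fconv_absum (wt : Zd -> R) (A B : Zd -> expsum) M N :
  (forall n, 0 <= wt n) -> (forall n m, wt (n + m) <= wt n * wt m) ->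
  absum (fun n => wt n * fnorm (A n)) M -> absum (fun n => wt n * fnorm (B n)) N ->
  absum (fun n => wt n * fnorm (fconv A B n)) (M * N).
Proof.
move=> wt0 wtD AM BN s us; pose K := undup (flatten [seq zbox n | n <- s]).
have a0 n : 0 <= wt n * fnorm (A n) by rewrite mulr_ge0 ?fnorm_ge0.
have b0 n : 0 <= wt n * fnorm (B n) by rewrite mulr_ge0 ?fnorm_ge0.
apply: (@le_trans _ _ (\sum_(n <- s) \sum_(m <- K)
    (wt m * fnorm (A m)) * (wt (n - m) * fnorm (B (n - m))))).
  rewrite big_seq [leRHS]big_seq; apply: ler_sum => n ns.
  rewrite [leRHS](bigID (mem (zbox n)))/= -[X in _ <= X + _]big_filter.
  have -> : wt n * fnorm (fconv A B n) =
      \sum_(m <- [seq m <- K | m \in zbox n]) wt n * (fnorm (A m) * fnorm (B (n - m))).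
    rewrite fnorm_flatten mulr_sumr; under eq_bigr do rewrite fnorm_fmul.
    apply: perm_big; apply: uniq_perm; rewrite ?zbox_uniq ?filter_uniq ?undup_uniq// => m.
    rewrite mem_filter mem_undup; case mn : (m \in zbox n) => //=.
    by apply/esym/flattenP; exists (zbox n) => //; exact: map_f.
  rewrite -[leLHS]addr0 lerD//; last by apply: sumr_ge0 => m _; exact: mulr_ge0.
  apply: ler_sum => m _; rewrite mulrACA ler_wpM2r ?mulr_ge0 ?fnorm_ge0//.
  by rewrite -[in leLHS](subrKC m n) (wtD m).
rewrite exchange_big /=.
apply: (@le_trans _ _ (\sum_(m <- K) wt m * fnorm (A m) * N)).
  apply: ler_sum => m _; rewrite -mulr_sumr ler_wpM2l//.
  rewrite -(big_map (fun n => n - m) xpredT (fun n => wt n * fnorm (B n))).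
  by apply: BN; rewrite map_inj_uniq// => x y /addIr.
rewrite -mulr_suml ler_wpM2r//; first exact: absum_ge0 BN.
exact/AM/undup_uniq.
Qed.

Lemma fpow_absum (wt : Zd -> R) (A : Zd -> expsum) M q :
  (forall n, 0 <= wt n) -> (forall n m, wt (n + m) <= wt n * wt m) -> wt 0 <= 1 ->
  absum (fun n => wt n * fnorm (A n)) M ->
  absum (fun n => wt n * fnorm (fpow A q n)) (M ^+ q).
Proof.
move=> wt0 wtD wt1 AM; elim: q => [|q IH]; last by rewrite exprS; exact: fconv_absum.
move=> s us; rewrite expr0.
apply: (@le_trans _ _ (\sum_(n <- s) (n == 0)%:R)).
  apply: ler_sum => n _ /=; rewrite /fnorm; have [->|_] := eqVneq n 0.
    by rewrite big_seq1 ComplexField.Normc.normc1 mulr1.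
  by rewrite big_nil mulr0.
rewrite -natr_sum lern1 -big_mkcond /= sum1_count.
by rewrite (eq_count (a2 := pred1 0))// count_uniq_mem//; case: (_ \in _).
Qed.

Lemma fpow_agree (A B : Zd -> expsum) K :
  (forall n, (norm1 n < K)%N -> A n = B n) ->
  forall q n, (norm1 n < K)%N -> fpow A q n = fpow B q n.
Proof.
move=> AB; elim=> [//|q IH] n nK /=; congr flatten; apply/eq_in_map => m mn.
by have e := norm1B mn; rewrite AB ?IH//; lia.
Qed.

End exponential_sums.

(** * Recursive construction of the coefficients *)

Section recursive_solution.
Variables (R : realType) (d p : nat) (w : 'rV[R]_d).
Hypotheses (hd : (1 <= d)%N) (hp : (2 <= p)%N) (hw : forall i, w ord0 i != 0).
Local Notation Zd := ('rV[int]_d).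
Implicit Types (m n k : Zd) (A B : Zd -> expsum R d).
Variable a0 : Zd -> R[i].

Let W : R := \sum_(i < d) w ord0 i ^+ 2.

Let W_gt0 : 0 < W.
Proof.
rewrite /W (bigD1 (Ordinal hd))//= ltr_pwDl ?sumr_ge0// => [|i _]; last exact: sqr_ge0.
by rewrite exprn_even_gt0//= hw.
Qed.

(** The rate at which [cis (angle k th)] turns along the orbit [th_i = w_i^2 t]. *)
Definition frequency k : R := \sum_i w ord0 i ^+ 2 * (k ord0 i)%:~R.

(** The integer frequency of the free wave of mode [n]; it makes the free evolution a function on
    the torus of angles. *)
Definition square n : Zd := \row_i (n ord0 i ^+ 2).

Lemma frequency_square n : frequency (square n) = dispersion w n.
Proof. by apply: eq_bigr => i _; rewrite mxE rmorphXn. Qed.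

Lemma frequencyD k m : frequency (k + m) = frequency k + frequency m.
Proof.
by rewrite /frequency -big_split; apply: eq_bigr => i _ /=; rewrite mxE rmorphD mulrDr.
Qed.

Lemma angle_frequency k t : angle k (\row_i (w ord0 i ^+ 2 * t)) = frequency k * t.
Proof. by rewrite /frequency mulr_suml; apply: eq_bigr => i _; rewrite mxE; ring. Qed.

(* Each term [c e^(i lambda tau)] of the forcing contributes
   [c (e^(i lambda t) - e^(i D t)) / (D - lambda)] to mode [n], where [D = dispersion n]. *)
Definition fsolve n (P : expsum R d) : expsum R d :=
  flatten [seq [:: (e.1 * ((dispersion w n - frequency e.2)^-1)%:C, e.2);
                   (- (e.1 * ((dispersion w n - frequency e.2)^-1)%:C), square n)] | e <- P].

(** Duhamel's formula at mode [n], with the forcing computed from [A]; the solution is a fixed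
    point. *)
Definition solve_step A n : expsum R d :=
  if positive n then (a0 n, square n) :: fsolve n (fpow A p n) else [::].

(** The invariant of the recursion: a one-sided bound, sharp for the free wave, from which the gap
    for products follows. *)
Definition admissible A : Prop := forall n e, e \in A n ->
  positive n /\ frequency e.2 <= dispersion w n.

(* The absence of small divisors: a product of [q] strictly positive modes
   with total mode [n] oscillates more slowly than mode [n] does. *)
Lemma fpow_gap A q n e : admissible A -> e \in fpow A q n ->
  (forall i, q%:Z <= n ord0 i) /\
  frequency e.2 <= dispersion w n - W * (q * q.-1)%:R.
Proof.
move=> hA; elim: q n e => [|q IH] n e /=.
  have [->|//] := eqVneq n 0; rewrite inE => /eqP -> /=.
  split=> [i|]; first by rewrite mxE.
  rewrite mul0n mulr0 subr0 le_eqVlt; apply/orP; left; apply/eqP.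
  rewrite /frequency /dispersion !big1// => i _.
    by rewrite mxE expr0n/= mulr0.
  by rewrite mxE mulr0.
move=> /mem_fconv[m [f [g [mn fA gB ->]]]].
have [/forallP mpos mle] := hA _ _ fA; have [nq nle] := IH _ _ gB.
split=> [i|].
  by have := mpos i; have := nq i; rewrite !mxE; move: (m ord0 i) (n ord0 i) => a b; lia.
(* Adding one factor: [n_i^2 - m_i^2 - (n_i - m_i)^2 = 2 m_i (n_i - m_i) >= 2 q], since [m_i >= 1]
   and the other [q] factors give [n_i - m_i >= q]. The increments [2 j] for [j < q] add up to
   [q (q - 1)]. *)
have cross : W * (2 * q%:R) <= dispersion w n - dispersion w m - dispersion w (n - m).
  rewrite /W /dispersion mulr_suml -!sumrB; apply: ler_sum => i _.
  have -> : w ord0 i ^+ 2 * (n ord0 i)%:~R ^+ 2 - w ord0 i ^+ 2 * (m ord0 i)%:~R ^+ 2 -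
      w ord0 i ^+ 2 * ((n - m) ord0 i)%:~R ^+ 2 =
      w ord0 i ^+ 2 * (2 * ((m ord0 i)%:~R * ((n - m) ord0 i)%:~R)) :> R.
    by rewrite !mxE rmorphB /=; ring.
  rewrite ler_wpM2l ?sqr_ge0// ler_pM2l//.
  have h1 : (1 : R) <= (m ord0 i)%:~R by rewrite -[1]/(1%:~R) ler_int mpos.
  have h2 : (q%:R : R) <= ((n - m) ord0 i)%:~R by rewrite -[q%:R]/(q%:Z%:~R) ler_int nq.
  by rewrite -[leLHS]mul1r ler_pM.
rewrite frequencyD.
have e1 : (q.+1 * q)%:R = 2 * q%:R + (q * q.-1)%:R :> R.
  by case: q {IH gB nq nle cross} => [|q]; rewrite ?mul0n ?muln0 ?mulr0 ?addr0// !natrM -!natr1; ring.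
rewrite /= e1 mulrDr; lra.
Qed.

Lemma fpow_positive A q n : (0 < q)%N -> admissible A -> ~~ positive n -> fpow A q n = [::].
Proof.
move=> q0 hA npos; case E : (fpow A q n) => [//|e s].
have : e \in fpow A q n by rewrite E inE eqxx.
move=> /(fpow_gap hA)[nq _]; case/negP: npos; apply/forallP => i.
by have := nq i; lia.
Qed.

Let gap : R := W * (p * p.-1)%:R.

Let gap_gt0 : 0 < gap.
Proof. by rewrite mulr_gt0// ltr0n muln_gt0; lia. Qed.

Lemma solve_step_admissible A : admissible A -> admissible (solve_step A).
Proof.
move=> hA n e; rewrite /solve_step; case: ifP => // npos.
rewrite inE => /predU1P[->|/flattenP[_ /mapP[f fA ->]]]; first by rewrite frequency_square.
rewrite !inE => /orP[] /eqP -> /=; last by rewrite frequency_square.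
have [_ h] := fpow_gap hA fA; split => //; have := gap_gt0; rewrite /gap; lra.
Qed.

(** Each term [c] of the forcing yields two terms of size [|c| / (D - lambda)], and
    [D - lambda >= gap]; hence the 2. *)
Lemma fnorm_fsolve A n : admissible A ->
  fnorm (fsolve n (fpow A p n)) <= 2 / gap * fnorm (fpow A p n).
Proof.
move=> hA; rewrite fnorm_flatten /fnorm mulr_sumr big_seq [leRHS]big_seq.
apply: ler_sum => e eA; rewrite big_cons big_seq1 /= normc_opp.
have [_ h] := fpow_gap hA eA; have g0 := gap_gt0.
have D0 : gap <= dispersion w n - frequency e.2 by rewrite /gap; lra.
rewrite ComplexField.Normc.normcM normc_real.
rewrite ger0_norm ?invr_ge0; last by lra.
have : (dispersion w n - frequency e.2)^-1 <= gap^-1.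
  by rewrite lef_pV2// posrE; lra.
have := normc_ge0 e.1; rewrite -/(ComplexField.Normc.normc e.1).
set y := _^-1; set z := gap^-1; set x := ComplexField.Normc.normc e.1.
nra.
Qed.

(** Each step gains one order of size: mode [n] of the power involves only modes strictly smaller
    than [n], as [p >= 2] leaves at least one other positive factor. *)
Lemma solve_step_agree A B K : admissible A -> admissible B ->
  (forall n, (norm1 n < K)%N -> A n = B n) ->
  forall n, (norm1 n <= K)%N -> solve_step A n = solve_step B n.
Proof.
move=> hA hB AB n nK; rewrite /solve_step; case: ifP => // npos.
congr (_ :: fsolve n _); case: p hp => [//|q] hq /=.
congr flatten; apply/eq_in_map => m mn; have e := norm1B mn.
have [mpos|mneg] := boolP (positive m); last first.
  have nil X : admissible X -> X m = [::].
    by move=> hX; case E : (X m) => [//|f s]; have [] := hX m f; rewrite ?E ?inE ?eqxx// (negbTE mneg).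
  by rewrite (nil A)// (nil B).
have m0 := positive_norm1 hd mpos.
have pow : fpow A q (n - m) = fpow B q (n - m) by apply: fpow_agree AB _ _ _; lia.
(* If [n - m] has size 0, then [m] is as large as [n]; but the remaining [q >= 1] positive modes
   cannot add up to a mode of size 0, so the term is empty on both sides. *)
have [mn0|nm] := eqVneq (norm1 (n - m)) 0%N; last by rewrite pow AB//; lia.
have npos' : ~~ positive (n - m).
  by apply/negP => /(positive_norm1 hd); rewrite mn0.
by rewrite !(fpow_positive _ _ npos') ?fmul_nil//; lia.
Qed.

Definition solve_iter j : Zd -> expsum R d := iter j solve_step (fun=> [::]).

Lemma solve_iter_admissible j : admissible (solve_iter j).
Proof. by elim: j => [//|j IH]; exact: solve_step_admissible. Qed.

Lemma solve_iter_stable K j j' n : (K <= j)%N -> (K <= j')%N -> (norm1 n < K)%N ->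
  solve_iter j n = solve_iter j' n.
Proof.
elim: K j j' n => [//|K IH] [//|j] [//|j'] n jK jK' nK.
apply: (@solve_step_agree _ _ K); try exact: solve_iter_admissible; last exact: nK.
by move=> m mK; apply: IH.
Qed.

(** Iterate [j] is final on all modes of size below [j], so mode [n] can be read off from iterate
    [norm1 n + 1]. *)
Definition coefficient n : expsum R d := solve_iter (norm1 n).+1 n.

Lemma coefficient_iter j n : (norm1 n < j)%N -> coefficient n = solve_iter j n.
Proof. by move=> nj; apply: (@solve_iter_stable (norm1 n).+1). Qed.

Lemma coefficient_admissible : admissible coefficient.
Proof. by move=> n; exact: solve_iter_admissible. Qed.

Lemma coefficientE n : coefficient n = solve_step coefficient n.
Proof.
apply: (@solve_step_agree _ _ (norm1 n)) => //.
- exact: solve_iter_admissible.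
- exact: coefficient_admissible.
- by move=> m mn; apply/esym; exact: coefficient_iter.
Qed.

Variables (wt : Zd -> R).
Hypotheses (wt0 : forall n, 0 <= wt n) (wtD : forall n m, wt (n + m) <= wt n * wt m)
  (wt1 : wt 0 <= 1).
Let rho : R := (W * (p%:R - 1) / 2) `^ (p%:R - 1)^-1.
Hypothesis a0_small : absum (fun n => wt n * normc (a0 n)) ((p%:R - 1) / p%:R * rho).

Let p1 : 1 <= p%:R - 1 :> R.
Proof. by rewrite lerBrDr -[1 + 1]/(2%:R) ler_nat. Qed.

(* The radius [rho] balances the two terms of Duhamel's formula. *)
Let rho_balance : 2 / gap * rho ^+ p = rho / p%:R.
Proof.
have b0 : 0 < W * (p%:R - 1) / 2 by rewrite divr_gt0// mulr_gt0//; exact: lt_le_trans p1.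
have e1 : rho ^+ p.-1 = W * (p%:R - 1) / 2.
  rewrite /rho -powR_mulrn ?powR_ge0// -powRrM.
  have -> : p.-1%:R = p%:R - 1 :> R by rewrite -subn1 natrB//; lia.
  by rewrite mulVf ?powRr1 ?ltW// gt_eqF//; have := p1; lra.
have -> : rho ^+ p = rho * rho ^+ p.-1 by rewrite -exprS prednK//; lia.
rewrite e1 /gap natrM.
have -> : p.-1%:R = p%:R - 1 :> R by rewrite -subn1 natrB//; lia.
have := W_gt0; have := p1 => h1 h2; field.
by rewrite !gt_eqF//; lra.
Qed.

(** The ball is stable because [rho] splits into [(p - 1) / p * rho], the size allowed to the datum,
    and [rho / p], which by [rho_balance] is the cost of the forcing. *)
Lemma solve_step_absum A : admissible A ->
  absum (fun n => wt n * fnorm (A n)) rho -> absum (fun n => wt n * fnorm (solve_step A n)) rho.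
Proof.
move=> hA Arho s us.
have split_rho : rho = (p%:R - 1) / p%:R * rho + 2 / gap * rho ^+ p.
  by rewrite rho_balance; have := p1 => h1; field; rewrite gt_eqF//; lra.
rewrite [leRHS]split_rho; apply: (@le_trans _ _ (\sum_(n <- s) wt n * normc (a0 n) +
    2 / gap * \sum_(n <- s) wt n * fnorm (fpow A p n))).
  rewrite mulr_sumr -big_split; apply: ler_sum => n _ /=.
  rewrite mulrCA -mulrDr ler_wpM2l// /solve_step; case: ifP => _.
    by rewrite {1}/fnorm big_cons lerD2l; exact: fnorm_fsolve.
  rewrite {1}/fnorm big_nil addr_ge0 ?normc_ge0//.
  by rewrite mulr_ge0 ?fnorm_ge0// divr_ge0// ltW// gap_gt0.
rewrite lerD ?a0_small// ler_wpM2l//; first by rewrite divr_ge0// ltW// gap_gt0.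
exact: fpow_absum.
Qed.

(** On a finite list of modes the coefficients coincide with a single iterate, and all iterates lie
    in the ball. *)
Lemma coefficient_absum : absum (fun n => wt n * fnorm (coefficient n)) rho.
Proof.
have rho0 : 0 <= rho by exact: powR_ge0.
have it j : absum (fun n => wt n * fnorm (solve_iter j n)) rho.
  elim: j => [|j IH]; last by apply: solve_step_absum => //; exact: solve_iter_admissible.
  by move=> s us; rewrite big1// => n _; rewrite /fnorm big_nil mulr0.
move=> s us; pose J := (\max_(n <- s) (norm1 n).+1)%N.
rewrite big_seq (eq_bigr (fun n => wt n * fnorm (solve_iter J n))); last first.
  move=> n ns; rewrite (@coefficient_iter J)// /J (big_rem n)//= leq_max ltnSn.
  by [].
by rewrite -big_seq; exact: it.
Qed.

End recursive_solution.

(** * Duhamel integrals of exponentials *)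

Section oriented_integrals.
Variable R : realType.
Local Notation leb := (@lebesgue_measure R).

Lemma eq_oriented (t : R) (f g : R -> R[i]) : f =1 g ->
  oriented_cintegral 0 t f = oriented_cintegral 0 t g.
Proof. by move=> fg; have -> : f = g by apply/funext. Qed.

Lemma oriented_sum (I : Type) (r : seq I) (z : I -> R[i]) (f : I -> R -> R[i]) (t : R) :
  (forall i a b, cintegrable leb `[a, b]%classic (f i)) ->
  oriented_cintegral 0 t (fun x => \sum_(i <- r) z i * f i x) =
  \sum_(i <- r) z i * oriented_cintegral 0 t (f i).
Proof.
move=> cf; rewrite /oriented_cintegral.
have key a b : cintegral leb `[a, b]%classic (fun x => \sum_(i <- r) z i * f i x) =
    \sum_(i <- r) z i * cintegral leb `[a, b]%classic (f i).
  rewrite cintegral_sum//; last by move=> i; apply: cintegrableZ => //; exact: measurable_itv.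
  by apply: eq_bigr => i _; rewrite cintegralZ//; exact: measurable_itv.
case: ifP => _; first exact: key.
by rewrite key -sumrN; apply: eq_bigr => i _; rewrite mulrN.
Qed.

Lemma oriented_cis (c t : R) :
  'i%C * c%:C * oriented_cintegral 0 t (fun x => cis (c * x)) = cis (c * t) - 1.
Proof.
rewrite /oriented_cintegral; have [t0|t0] := leP 0 t.
  by rewrite cintegral_cis_lin// mulr0 cis0.
by rewrite mulrN cintegral_cis_lin ?ltW// mulr0 cis0 opprB.
Qed.

(** Integrates one forcing exponential [cis (l * x)]; its propagator [cis (D * (t - x))] is split
    into a constant and a factor merged with the forcing. The right side is, up to sign, the pair of
    terms built by [fsolve]. *)
Lemma duhamel_term (D l t : R) : D - l != 0 ->
  'i%C * oriented_cintegral 0 t (fun x => cis (D * t) * cis ((l - D) * x)) =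
  ((D - l)^-1)%:C * (cis (D * t) - cis (l * t)).
Proof.
move=> Dl.
have -> : oriented_cintegral 0 t (fun x => cis (D * t) * cis ((l - D) * x)) =
    cis (D * t) * oriented_cintegral 0 t (fun x => cis ((l - D) * x)).
  have := @oriented_sum unit [:: tt] (fun=> cis (D * t)) (fun _ x => cis ((l - D) * x)) t
    (fun _ a b => cintegrable_cis_lin a b _).
  rewrite big_seq1 => <-; apply: eq_oriented => x; rewrite big_seq1.
  by [].
have e := oriented_cis (l - D) t.
have e2 : cis (l * t) = cis (D * t) * cis ((l - D) * t) by rewrite -cisD; congr cis; ring.
have e3 : ((D - l)^-1)%:C * (l - D)%:C = -1 :> R[i].
  rewrite -rmorphM; have -> : (D - l)^-1 * (l - D) = -1 by field.
  by rewrite rmorphN1.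
transitivity (((D - l)^-1)%:C * - (cis (D * t) *
  ('i%C * (l - D)%:C * oriented_cintegral 0 t (fun x => cis ((l - D) * x))))).
  set I := oriented_cintegral _ _ _.
  transitivity (- (((D - l)^-1)%:C * (l - D)%:C) * ('i%C * (cis (D * t) * I))); last by ring.
  by rewrite e3 opprK mul1r.
by rewrite e e2; ring.
Qed.

End oriented_integrals.

Section nonnegative_modes.
Variables (R : realType) (d : nat) (w : 'rV[R]_d).
Hypothesis hw : forall i, w ord0 i != 0.
Local Notation fourier := (fourier w).
Local Notation Zd := ('rV[int]_d).

(** A nonzero term needs both [m] and [n - m] nonnegative, so the truncated convolutions are
    eventually the finite sum over the box. *)
Lemma fourierM_nonneg u v M N n : wbound w u M -> wbound w v N ->
  (forall m, fourier u m != 0 -> forall i, 0 <= m ord0 i) ->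
  (forall m, fourier v m != 0 -> forall i, 0 <= m ord0 i) ->
  fourier (fun x => u x * v x) n = \sum_(m <- zbox n) fourier u m * fourier v (n - m).
Proof.
move=> uM vN u0 v0; have h := ccvg_fourierM hw n uM vN.
apply: ccvg_unique h _; apply/ccvg_normcP; apply: cvg_near_cst.
have [N0 hN0] := cenum_sup (zbox n); exists N0 => // k /= kN.
rewrite (big_uniq_subset (t := zbox n)) ?cenum_uniq ?zbox_uniq//.
- by rewrite subrr ComplexField.Normc.normc0.
- exact: hN0.
- move=> m; apply: contraNeq; rewrite mulf_eq0 negb_or => /andP[/u0 um /v0 vm].
  apply/zboxP => i; have := um i; have := vm i; rewrite !mxE.
  by move: (m ord0 i) (n ord0 i) => a b; lia.
Qed.

End nonnegative_modes.

(** * The global solution *)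

Section global_solution.
Variables (R : realType) (d p : nat) (w : 'rV[R]_d) (s : R).
Hypotheses (hd : (1 <= d)%N) (hp : (2 <= p)%N) (hw : forall i, w ord0 i != 0) (hs : 0 <= s).
Local Notation Zd := ('rV[int]_d).
Local Notation fourier := (fourier w).
Variable a0 : Zd -> R[i].
Let W : R := \sum_(i < d) w ord0 i ^+ 2.
Let rho : R := (W * (p%:R - 1) / 2) `^ (p%:R - 1)^-1.
Hypothesis a0_small : absum (fun n => weight s n * normc (a0 n)) ((p%:R - 1) / p%:R * rho).
Hypothesis a0_pos : forall n, a0 n != 0 -> forall i, 1 <= n ord0 i.

Local Notation A := (coefficient p w a0).
Let hA : admissible w A. Proof. by move=> n e; exact: coefficient_admissible. Qed.

Let weight0 : weight s (0 : Zd) <= 1.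
Proof.
rewrite /weight /norm1 big1 => [|i _]; last by rewrite mxE.
by rewrite addr0; have /(congr1 (@^~ s)) /= -> := powR1 R.
Qed.

Let A_absum : absum (fun n => weight s n * fnorm (A n)) rho.
Proof.
apply: coefficient_absum => //; first exact: weight_ge0.
by move=> n m; exact: weightD.
Qed.

(** The map [F] on the torus of angles; the solution is read along [th_i = w_i^2 t]. *)
Definition wave th : d.-tuple R -> R[i] := synth w (fun n => feval th (A n)).

Let feval_absum th : absum (fun n => weight s n * normc (feval th (A n))) rho.
Proof.
by apply: absum_le A_absum => n; rewrite ler_wpM2l ?weight_ge0// normc_feval.
Qed.

Lemma wave_wnorm th : (wnorm w s (wave th) <= rho%:E)%E.
Proof. by case: (wnorm_synth hw hs (feval_absum th)). Qed.

Lemma fourier_wave th n : fourier (wave th) n = feval th (A n).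
Proof. by case: (wnorm_synth hw hs (feval_absum th)). Qed.

Lemma wave_plus th : wiener_plus w s (wave th).
Proof.
split; first by case: (wnorm_synth hw hs (feval_absum th)).
move=> n; rewrite fourier_wave => An i.
case E : (A n) => [|e r]; first by move: An; rewrite E /feval big_nil eqxx.
have [|/forallP pn _] := @hA n e; first by rewrite E inE eqxx.
by apply: le_trans (pn i).
Qed.

Lemma wave_continuous : wcontinuous w s setT wave.
Proof.
apply: (wcontinuous_synth hw hs (b := fun n => fnorm (A n))) A_absum _ => //.
- by move=> th n; exact: normc_feval.
- by move=> n th; exact: ccvg_feval.
Qed.

Lemma wave_periodic (m : Zd) th x :
  wave (th + \row_i (2 * pi * (m ord0 i)%:~R)) x = wave th x.
Proof.
rewrite /wave; congr (synth w _ x); apply/funext => n.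
exact: feval_periodic.
Qed.

(** Both claims go through one induction, because the product formula at [q + 1] needs a Wiener
    bound on the power [q]. *)
Lemma fourier_waveX th q n :
  (exists M, wbound w (fun x => wave th x ^+ q) M) /\
  fourier (fun x => wave th x ^+ q) n = feval th (fpow A q n).
Proof.
have wb1 : wbound w (wave th) rho.
  by apply: wbound_wnorm (wave_wnorm th) => //; case: (wave_plus th) => -[[_]].
elim: q n => [|q IH] n /=.
  under [X in wbound _ X]eq_fun do rewrite expr0.
  under [X in fourier X]eq_fun do rewrite expr0.
  split; first by exists 1; exact: wbound1.
  rewrite fourier1//; case: (n == 0); rewrite /feval ?big_nil//.
  rewrite big_seq1 mul1r /angle big1 ?cis0// => i _.
  by rewrite mxE mul0r.
under [X in wbound _ X]eq_fun do rewrite exprS.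
under [X in fourier X]eq_fun do rewrite exprS.
have [[M wbq] _] := IH n.
split; first by exists (rho * M); exact: wboundM.
rewrite (fourierM_nonneg hw n wb1 wbq).
- rewrite feval_flatten; apply: eq_bigr => m _.
  by rewrite feval_fmul fourier_wave (IH (n - m)).2.
- by case: (wave_plus th).
- move=> m; rewrite (IH m).2 => An i.
  case E : (fpow A q m) => [|e r]; first by move: An; rewrite E /feval big_nil eqxx.
  have [|qm _] := @fpow_gap _ _ _ _ hd hp hw _ q m e (@hA); first by rewrite E inE eqxx.
  by apply: le_trans (qm i).
Qed.

Let orbit t : 'rV[R]_d := \row_i (w ord0 i ^+ 2 * t).

Let feval_orbit t P : feval (orbit t) P = \sum_(e <- P) e.1 * cis (frequency w e.2 * t).
Proof. by apply: eq_bigr => e _; rewrite angle_frequency. Qed.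

(** Along the orbit the fixed point equation [coefficientE] is Duhamel's formula, matched
    exponential by exponential through [duhamel_term]. *)
Lemma wave_duhamel t n :
  fourier (wave (orbit t)) n = cis (dispersion w n * t) * a0 n -
    'i%C * oriented_cintegral 0 t (fun tau => cis (dispersion w n * (t - tau)) *
      fourier (fun x => wave (orbit tau) x ^+ p) n).
Proof.
pose D := dispersion w n.
rewrite fourier_wave coefficientE// /solve_step.
rewrite (@eq_oriented _ _ _ (fun tau => \sum_(e <- fpow A p n)
    e.1 * (cis (D * t) * cis ((frequency w e.2 - D) * tau)))); last first.
  move=> tau; rewrite (fourier_waveX _ p n).2 feval_orbit mulr_sumr.
  apply: eq_bigr => e _; rewrite mulrCA -!cisD; congr (_ * cis _).
  by rewrite /D; ring.
rewrite oriented_sum; last first.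
  move=> e a b; apply: cintegrableZ; first exact: measurable_itv.
  exact: cintegrable_cis_lin.
(* Off the strictly positive modes all terms vanish: no product of positive modes reaches [n], and
   the datum has no such mode. *)
have [npos|nneg] := boolP (positive n); last first.
  rewrite (fpow_positive hd hp hw _ (@hA) nneg) ?big_nil ?mulr0 ?subr0; last by lia.
  rewrite /feval big_nil; have [->|/a0_pos n1] := eqVneq (a0 n) 0; first by rewrite mulr0.
  by case/negP: nneg; apply/forallP.
rewrite feval_orbit big_cons frequency_square mulrC; congr (_ + _).
rewrite /fsolve big_flatten big_map mulr_sumr -sumrN big_seq [RHS]big_seq.
apply: eq_bigr => e eA; rewrite big_cons big_seq1 /= frequency_square.
have Dl : D - frequency w e.2 != 0.
  have [_ h] := fpow_gap hd hp hw (@hA) eA; rewrite gt_eqF// subr_gt0 (le_lt_trans h)//.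
  rewrite gtrBl mulr_gt0//; last by rewrite ltr0n muln_gt0; lia.
  rewrite (bigD1 (Ordinal hd))//= ltr_pwDl ?sumr_ge0// => [|i _]; last exact: sqr_ge0.
  by rewrite exprn_even_gt0//= hw.
rewrite mulrCA duhamel_term// -/D.
by ring.
Qed.

End global_solution.

(** * Uniqueness of solutions *)

Section integral_estimates.
Variable R : realType.
Local Notation leb := (@lebesgue_measure R).

(* A factor of modulus at most 1 turning [z] into [normc z]; it lets a sum of
   moduli of integrals be bounded through a single integral. *)
Definition unphase (z : R[i]) : R[i] := if z == 0 then 0 else (normc z)%:C / z.

Lemma normc_unphase z : normc (unphase z) <= 1.
Proof.
rewrite /unphase; case: eqVneq => [_|z0].
  by rewrite ComplexField.Normc.normc0.
rewrite ComplexField.Normc.normcM ComplexField.Normc.normcV normc_real.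
rewrite ger0_norm ?normc_ge0// divff//.
by apply: contra_neq z0; exact: ComplexField.Normc.eq0_normc.
Qed.

Lemma unphaseM z : unphase z * z = (normc z)%:C.
Proof.
rewrite /unphase; case: eqVneq => [->|z0]; last by rewrite divfK.
by rewrite mulr0 ComplexField.Normc.normc0.
Qed.

Lemma sum_normc_cintegral (disp : measure_display) (T : measurableType disp)
    (mu : {measure set T -> \bar R}) (D : set T) (I : Type) (r : seq I)
    (g : I -> T -> R[i]) (H : T -> R) : measurable D ->
  (forall i, cintegrable mu D (g i)) -> mu.-integrable D (EFin \o H) ->
  (forall x, D x -> \sum_(i <- r) normc (g i x) <= H x) ->
  \sum_(i <- r) normc (cintegral mu D (g i)) <= \int[mu]_(x in D) H x.
Proof.
move=> mD ig iH gH; pose z i := unphase (cintegral mu D (g i)).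
have izg i : cintegrable mu D (fun x => z i * g i x) by exact: cintegrableZ.
have e : (\sum_(i <- r) normc (cintegral mu D (g i)))%:C =
    cintegral mu D (fun x => \sum_(i <- r) z i * g i x).
  rewrite cintegral_sum// rmorph_sum; apply: eq_bigr => i _.
  by rewrite cintegralZ// /z unphaseM.
have := congr1 (@complex.Re R) e; rewrite /= => ->.
have [ir _] := cintegrable_sum mD r izg.
apply: le_Rintegral => // x Dx; apply: le_trans (gH x Dx).
apply: (le_trans (ler_norm _)); apply: (le_trans (normc_ge_absRe _)).
apply: (le_trans (normc_sum _ _)); apply: ler_sum => i _.
by rewrite ComplexField.Normc.normcM ler_piMl ?normc_ge0 ?normc_unphase.
Qed.

Definition segment0 (t : R) : set (measurableTypeR R) :=
  `[Num.min 0 t, Num.max 0 t]%classic.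

Lemma measurable_segment0 t : measurable (segment0 t).
Proof. exact: measurable_itv. Qed.

Lemma segment0_ge0 t : 0 <= t -> segment0 t = `[0, t]%classic.
Proof. by move=> t0; rewrite /segment0 min_l// max_r. Qed.

Lemma segment0_le0 t : t <= 0 -> segment0 t = `[t, 0]%classic.
Proof. by move=> t0; rewrite /segment0 min_r// max_l. Qed.

Lemma segment0_sub t x : segment0 t x -> segment0 x `<=` segment0 t.
Proof.
rewrite /segment0 /= in_itv /= ge_min le_max => tx y; rewrite /= !in_itv /=.
rewrite !ge_min !le_max; move: tx.
by case: (leP 0 t); case: (leP 0 x); case: (leP t x); case: (leP x t) => //=; lra.
Qed.

Lemma segment0_right t : segment0 t t.
Proof. by rewrite /segment0 /= in_itv /= ge_min le_max !lexx !orbT. Qed.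

Lemma normc_oriented t (f : R -> R[i]) :
  normc (oriented_cintegral 0 t f) = normc (cintegral leb (segment0 t) f).
Proof.
rewrite /oriented_cintegral; have [t0|/ltW t0] := leP 0 t; first by rewrite segment0_ge0.
by rewrite normc_opp segment0_le0.
Qed.

Lemma orientedB t (f g : R -> R[i]) : cintegrable leb (segment0 t) f ->
  cintegrable leb (segment0 t) g ->
  oriented_cintegral 0 t (fun x => f x - g x) =
  oriented_cintegral 0 t f - oriented_cintegral 0 t g.
Proof.
rewrite /oriented_cintegral; have [t0|/ltW t0] := leP 0 t.
  by rewrite segment0_ge0// => cf cg; rewrite cintegralB//; exact: measurable_itv.
rewrite segment0_le0// => cf cg; rewrite cintegralB ?opprB 1?addrC ?opprK//.
Qed.

(** Supplies the factor [1 / (k + 1)] that builds the factorial of the Gronwall iteration, for both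
    signs of [t]. *)
Lemma Rintegral_abs_exp (t : R) k :
  \int[leb]_(x in segment0 t) (`|x| ^+ k) = `|t| ^+ k.+1 / k.+1%:R.
Proof.
have k0 : k.+1%:R != 0 :> R by rewrite pnatr_eq0.
have dp (x : R) : is_derive x 1 (k.+1%:R^-1 \*: (fun y : R => y ^+ k.+1)) (x ^+ k).
  have e : x ^+ k = k.+1%:R^-1 *: (k.+1%:R *: x ^+ k) by rewrite scalerA mulVf// scale1r.
  rewrite e; apply: is_deriveZ; apply: DeriveDef; first exact: exprn_derivable.
  by rewrite -derive1E exp_derive1.
have cX : continuous (fun x : R => x ^+ k) by exact: exprn_continuous.
have [t0|/ltW t0] := leP 0 t.
  rewrite segment0_ge0//; transitivity (\int[leb]_(x in `[0, t]) (x ^+ k)).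
    apply: eq_Rintegral => x /set_mem; rewrite /= in_itv/= => /andP[x0 _].
    by rewrite ger0_norm.
  rewrite (Rintegral_derive t0 cX dp) /= expr0n/= scaler0 subr0.
  by rewrite ger0_norm// /GRing.scale/= mulrC.
rewrite segment0_le0//; transitivity (\int[leb]_(x in `[t, 0]) ((-1) ^+ k * x ^+ k)).
  apply: eq_Rintegral => x /set_mem; rewrite /= in_itv/= => /andP[_ x0].
  by rewrite ler0_norm//; exact: exprNn.
rewrite RintegralZl//; last exact: integrable_continuous_itv.
rewrite (Rintegral_derive t0 cX dp) /= expr0n/= scaler0 sub0r.
rewrite ler0_norm// [in RHS]exprNn [(-1) ^+ k.+1]exprS -[_ *: _]/(_ * _).
ring.
Qed.

End integral_estimates.

Section wiener_powers.
Variables (R : realType) (d : nat) (w : 'rV[R]_d).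
Hypothesis hw : forall i, w ord0 i != 0.
Local Notation wbound := (wbound w).
Implicit Types u v : d.-tuple R -> R[i].

Lemma wboundX u M q : wbound u M -> wbound (fun x => u x ^+ q) (M ^+ q).
Proof.
move=> uM; elim: q => [|q IH].
  by under [X in wbound X]eq_fun do rewrite expr0; exact: wbound1.
by under [X in wbound X]eq_fun do rewrite exprS; rewrite exprS; exact: wboundM.
Qed.

(** A recursive form of [q M^(q - 1)], the Lipschitz constant of the [q]-th power on the ball of
    radius [M]; it follows the identity [u^(q+1) - v^(q+1) = u (u^q - v^q) + (u - v) v^q]. *)
Fixpoint power_lip (M : R) (q : nat) : R :=
  if q is q'.+1 then M * power_lip M q' + M ^+ q' else 0.

Lemma wbound_diffX u v M e q : wbound u M -> wbound v M ->
  wbound (fun x => u x - v x) e ->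
  wbound (fun x => u x ^+ q - v x ^+ q) (power_lip M q * e).
Proof.
move=> uM vM uv; elim: q => [|q IH].
  rewrite mul0r; under [X in wbound X]eq_fun do rewrite subrr.
  split; first exact: cintegrable0.
  move=> s us; rewrite big1// => n _; rewrite fourierE//.
  rewrite (@eq_cintegral _ _ _ _ _ _ (fun=> 0)); last by move=> x _; rewrite mul0r.
  by rewrite cintegral0 ?mulr0 ?ComplexField.Normc.normc0//; exact: measurable_cell.
have -> : power_lip M q.+1 * e = M * (power_lip M q * e) + e * M ^+ q by rewrite /=; ring.
rewrite (_ : (fun x => _) = fun x => u x * (u x ^+ q - v x ^+ q) + (u x - v x) * v x ^+ q).
  by apply: wboundD => //; apply: wboundM => //; exact: wboundX.
by apply/funext => x; rewrite !exprS; ring.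
Qed.

Lemma power_lip_ge0 M q : 0 <= M -> 0 <= power_lip M q.
Proof. by move=> M0; elim: q => //= q IH; rewrite addr_ge0 ?mulr_ge0 ?exprn_ge0. Qed.

End wiener_powers.

(** * Gronwall iteration *)

Section uniqueness.
Variables (R : realType) (d p : nat) (w : 'rV[R]_d) (s : R).
Hypotheses (hw : forall i, w ord0 i != 0) (hs : 0 <= s).
Local Notation Zd := ('rV[int]_d).
Local Notation fourier := (fourier w).
Local Notation leb := (@lebesgue_measure R).
Implicit Types u v : R -> d.-tuple R -> R[i].

Lemma wnorm_distC (u v : d.-tuple R -> R[i]) : wiener w s u -> wiener w s v ->
  wnorm w s (fun x => u x - v x) = wnorm w s (fun x => v x - u x).
Proof.
move=> [[_ iu] _] [[_ iv] _]; apply: eq_esum => n _.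
by rewrite !fourierB// normc_distC.
Qed.

Local Opaque wnorm Defs.fourier.

Lemma wnorm_triangle (u v : d.-tuple R -> R[i]) : wiener w s u -> wiener w s v ->
  (wnorm w s u <= wnorm w s v + wnorm w s (fun x => u x - v x)%R)%E.
Proof.
move=> [[_ iu] fu] [[_ iv] fv].
have fb : (wnorm w s (fun x => u x - v x)%R <= wnorm w s u + wnorm w s v)%E.
  rewrite (wnorm_fin fu) (wnorm_fin fv) -EFinD; apply/wnorm_leP => r ur.
  have /wnorm_leP/(_ r ur) hu : (wnorm w s u <= (fine (wnorm w s u))%:E)%E by rewrite -wnorm_fin.
  have /wnorm_leP/(_ r ur) hv : (wnorm w s v <= (fine (wnorm w s v))%:E)%E by rewrite -wnorm_fin.
  apply: le_trans (lerD hu hv); rewrite -big_split; apply: ler_sum => n _.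
  rewrite -[leRHS]mulrDr ler_wpM2l ?weight_ge0// fourierB//.
  by rewrite (le_trans (normcD_le _ _))// normc_opp.
have fd : (wnorm w s (fun x => u x - v x)%R < +oo)%E.
  exact: le_lt_trans fb (lte_add_pinfty fu fv).
rewrite (wnorm_fin fd) (wnorm_fin fv) -EFinD; apply/wnorm_leP => r ur.
have /wnorm_leP/(_ r ur) hu : (wnorm w s (fun x => u x - v x)%R <=
  (fine (wnorm w s (fun x => u x - v x)%R))%:E)%E by rewrite -wnorm_fin.
have /wnorm_leP/(_ r ur) hv : (wnorm w s v <= (fine (wnorm w s v))%:E)%E by rewrite -wnorm_fin.
apply: le_trans (lerD hv hu); rewrite -big_split; apply: ler_sum => n _.
rewrite -[leRHS]mulrDr ler_wpM2l ?weight_ge0// fourierB//.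
rewrite -{1}(subrK (fourier v n) (fourier u n)) addrC.
exact: normcD_le.
Qed.

Lemma wbound_fourier (u : d.-tuple R -> R[i]) M n : wbound w u M -> normc (fourier u n) <= M.
Proof. by move=> [_ /(_ [:: n] isT)]; rewrite big_seq1. Qed.

Section compact_segment.
Variables (a b : R) (v : R -> d.-tuple R -> R[i]).
Let K : set R := `[a, b]%classic.
Hypotheses (wv : forall t, K t -> wiener w s (v t)) (cv : wcontinuous w s K v).

Let diff_near x e : K x -> 0 < e ->
  \forall y \near nbhs x, K y -> (wnorm w s (fun z => v y z - v x z)%R <= e%:E)%E.
Proof.
move=> Kx e0; have := cv Kx => /cvg_ereal0P h.
by apply: h => // y; exact: wnorm_ge0.
Qed.

(** By the triangle inequality the norm is a continuous real function of time, so it has a maximum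
    on a nonempty segment. *)
Lemma wnorm_bounded : exists B, forall t, K t -> (wnorm w s (v t) <= B%:E)%E.
Proof.
have [ab|ba] := leP a b; last first.
  exists 0 => t; rewrite /K /= in_itv/= => /andP[ta tb].
  by have := le_lt_trans (le_trans ta tb) ba; rewrite ltxx.
pose N t := fine (wnorm w s (v t)).
have vN t : K t -> wnorm w s (v t) = (N t)%:E by move=> /wv[_ /wnorm_fin].
have Nle x y : K x -> K y -> forall e, (wnorm w s (fun z => v y z - v x z)%R <= e%:E)%E ->
    N y <= N x + e.
  move=> Kx Ky e h; suff : (wnorm w s (v y) <= wnorm w s (v x) + e%:E)%E.
    by rewrite (vN y Ky) (vN x Kx) -EFinD lee_fin.
  apply: (le_trans (wnorm_triangle (wv Ky) (wv Kx))); exact: leeD2l.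
have cN : {within K, continuous N}.
  apply/subspace_continuousP => x Kx; apply/cvgrPdist_le => e e0.
  apply: filterS (diff_near Kx e0) => y h Ky.
  have h1 := h Ky; have h2 := h1; rewrite wnorm_distC ?wv// in h2; try exact: wv.
  change (`|N x - N y| <= e).
  rewrite ler_distl lerBlDr; apply/andP; split; first exact: Nle Kx Ky _ h1.
  exact: Nle Ky Kx _ h2.
have [c _ hc] := EVT_max ab cN.
by exists (N c) => t Kt; rewrite (vN t Kt) lee_fin; exact: hc.
Qed.

Lemma fourierX_continuous q n x : K x ->
  ccvg (within K (nbhs x)) (fun y => fourier (fun z => v y z ^+ q) n)
    (fourier (fun z => v x z ^+ q) n).
Proof.
move=> Kx; have [B hB] := wnorm_bounded.
have wB t : K t -> wbound w (v t) B.
  by move=> Kt; apply: wbound_wnorm (hB t Kt) => //; have [[]] := wv Kt.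
have B0 : 0 <= B by have [_ /absum_ge0] := wB x Kx.
have L0 := power_lip_ge0 q B0; set L := power_lip B q in L0.
apply/ccvg_normcP/cvgrPdist_le => e e0.
(* [L + 1] instead of [L], which may be zero. *)
have e1 : 0 < e / (L + 1) by rewrite divr_gt0// ltr_wpDl.
apply: filterS (diff_near Kx e1) => y h Ky.
rewrite sub0r normrN ger0_norm ?normc_ge0//.
have iX t : K t -> cintegrable (lebesgue_tuple R d) (cell w) (fun z => v t z ^+ q).
  by move=> Kt; have [] := wboundX hw q (wB t Kt).
rewrite -fourierB; try exact: iX; try exact: hw.
have dB : wbound w (fun z => v y z - v x z) (e / (L + 1)).
  apply: wbound_wnorm (h Ky) => //.
  by apply: cintegrableB; [exact: measurable_cell|have [] := wB y Ky|have [] := wB x Kx].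
apply: le_trans (wbound_fourier n (wbound_diffX hw q (wB y Ky) (wB x Kx) dB)) _.
have L1 : 0 < L + 1 by rewrite ltr_wpDl.
rewrite -/L mulrCA; apply: ler_piMr; first exact: ltW.
by rewrite ler_pdivrMr// mul1r lerDl.
Qed.

End compact_segment.

(** Iterating Duhamel's formula from the crude bound [2 B] bounds the unweighted norm of the
    difference at time [x] by [2 B (C |x|)^k / k!] for every [k], which tends to zero. Equal
    coefficients then give equality almost everywhere by [fourier_inj]. *)
Theorem duhamel_unique (J : set R) (u0 : d.-tuple R -> R[i]) u v :
  is_interval J -> J 0 -> solution w s p J u0 u -> solution w s p J u0 v ->
  forall t, J t -> torus_aeq w (v t) (u t).
Proof.
move=> iJ J0 [wu cu du] [wv cv dv] t Jt.
(* The segment between 0 and [t] lies in [J], an interval containing 0; its compactness provides one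
   bound [B] for both solutions. *)
pose K : set R := segment0 t.
have KJ x : K x -> J x.
  rewrite /K /segment0 /= in_itv /=; case: (leP 0 t) => _ h.
    exact: iJ J0 Jt _ h.
  exact: iJ Jt J0 _ h.
have wcK (f : R -> d.-tuple R -> R[i]) : wcontinuous w s J f -> wcontinuous w s K f.
  move=> cf x Kx; apply: cvg_trans (cf x (KJ x Kx)).
  by apply: cvg_app; apply: within_subset.
have [Bu hBu] := wnorm_bounded (fun x Kx => wu x (KJ x Kx)) (wcK _ cu).
have [Bv hBv] := wnorm_bounded (fun x Kx => wv x (KJ x Kx)) (wcK _ cv).
pose B := Num.max Bu Bv.
have wBu x : K x -> wbound w (u x) B.
  move=> Kx; apply: (wbound_wnorm hs); first by have [[]] := wu x (KJ x Kx).
  by apply: le_trans (hBu x Kx) _; rewrite lee_fin le_max lexx.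
have wBv x : K x -> wbound w (v x) B.
  move=> Kx; apply: (wbound_wnorm hs); first by have [[]] := wv x (KJ x Kx).
  by apply: le_trans (hBv x Kx) _; rewrite lee_fin le_max lexx orbT.
have K0 : K 0 by rewrite /K /segment0 /= in_itv /= ge_min le_max !lexx.
have B0 : 0 <= B by have [_ /absum_ge0] := wBu 0 K0.
pose C := power_lip B p.
have C0 : 0 <= C := power_lip_ge0 p B0.
pose D n x := fourier (v x) n - fourier (u x) n.
pose f (g : R -> d.-tuple R -> R[i]) x n y :=
  cis (dispersion w n * (x - y)) * fourier (fun z => g y z ^+ p) n.
(* The integrands are continuous in time, hence integrable, so the two Duhamel integrals can be
   subtracted under one integral sign. *)
have intf (g : R -> d.-tuple R -> R[i]) x n : (forall y, K y -> wiener w s (g y)) ->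
    wcontinuous w s K g -> K x -> cintegrable leb (segment0 x) (f g x n).
  move=> wg cg Kx.
  have cf y : K y -> ccvg (within K (nbhs y)) (f g x n) (f g x n y).
    move=> Ky; apply: ccvgM; last exact: fourierX_continuous wg cg p n y Ky.
    have cl : dispersion w n * (x - z) @[z --> y] --> dispersion w n * (x - y).
      by apply: cvgM; [exact: cvg_cst|apply: cvgB; [exact: cvg_cst|exact: cvg_id]].
    split; apply: cvg_within_filter => /=.
    - by apply: (cvg_comp _ _ cl); exact: continuous_cos.
    - by apply: (cvg_comp _ _ cl); exact: continuous_sin.
  have sK : segment0 x `<=` K by exact: segment0_sub.
  split; apply: continuous_compact_integrable; try exact: segment_compact.
  - apply: continuous_subspaceW sK _; apply/subspace_continuousP => y Ky.
    by have [] := cf y Ky.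
  - apply: continuous_subspaceW sK _; apply/subspace_continuousP => y Ky.
    by have [] := cf y Ky.
have dbound k x : K x ->
    absum (fun n => normc (D n x)) ((B + B) * (C ^+ k * `|x| ^+ k / k`!%:R)).
  elim: k x => [|k IH] x Kx r ur.
    rewrite !expr0 fact0 divr1 !mulr1.
    apply: le_trans (lerD ((wBv x Kx).2 r ur) ((wBu x Kx).2 r ur)).
    rewrite -big_split; apply: ler_sum => n _.
    by rewrite (le_trans (normcD_le _ _))// normc_opp.
  have DE n : normc (D n x) = normc (cintegral leb (segment0 x) (fun y => f v x n y - f u x n y)).
    have iv := intf v x n (fun y Ky => wv y (KJ y Ky)) (wcK _ cv) Kx.
    have iu := intf u x n (fun y Ky => wu y (KJ y Ky)) (wcK _ cu) Kx.
    rewrite -normc_oriented (orientedB iv iu).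
    pose Ov := oriented_cintegral 0 x (f v x n); pose Ou := oriented_cintegral 0 x (f u x n).
    have ev : fourier (v x) n = cis (dispersion w n * x) * fourier u0 n - 'i%C * Ov :=
      dv x n (KJ x Kx).
    have eu : fourier (u x) n = cis (dispersion w n * x) * fourier u0 n - 'i%C * Ou :=
      du x n (KJ x Kx).
    have -> : D n x = 'i%C * (Ou - Ov) by rewrite /D ev eu; ring.
    rewrite ComplexField.Normc.normcM.
    have -> : normc 'i%C = 1 :> R by rewrite /= expr0n expr1n add0r sqrtr1.
    by rewrite mul1r; exact: normc_distC.
  under eq_bigr do rewrite DE.
  pose c := C * ((B + B) * (C ^+ k / k`!%:R)).
  have cH : continuous (fun y : R => c * `|y| ^+ k).
    move=> y; apply: cvgM; first exact: cvg_cst.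
    apply: (@continuous_comp _ _ _ (fun y : R => `|y|) (fun y => y ^+ k)).
      exact: norm_continuous.
    exact: exprn_continuous.
  have iH : leb.-integrable (segment0 x) (EFin \o (fun y : R => c * `|y| ^+ k)).
    exact: integrable_continuous_itv.
  (* Summing over the modes before integrating keeps the Wiener norm of the difference under a
     single time integral, where the Lipschitz bound and the induction hypothesis apply. *)
  apply: le_trans (sum_normc_cintegral (measurable_segment0 x) _ iH _) _.
  - move=> n; apply: cintegrableB; first exact: measurable_segment0.
      exact: intf (fun y Ky => wv y (KJ y Ky)) (wcK _ cv) Kx.
    exact: intf (fun y Ky => wu y (KJ y Ky)) (wcK _ cu) Kx.
  - move=> y xy; have Ky : K y by exact: segment0_sub Kx _ xy.
    have dy : wbound w (fun z => v y z - u y z) ((B + B) * (C ^+ k * `|y| ^+ k / k`!%:R)).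
      have iv := (wBv y Ky).1; have iu := (wBu y Ky).1.
      split; first by apply: cintegrableB => //; exact: measurable_cell.
      by move=> r' ur'; under eq_bigr do rewrite fourierB//; exact: IH.
    have [_ /(_ r ur)] := wbound_diffX hw p (wBv y Ky) (wBu y Ky) dy.
    rewrite (_ : power_lip B p * _ = c * `|y| ^+ k); last by rewrite /c -/C; ring.
    apply: le_trans; apply: ler_sum => n _.
    rewrite /f -mulrBr ComplexField.Normc.normcM normc_cis mul1r fourierB//.
      by have [] := wboundX hw p (wBv y Ky).
    by have [] := wboundX hw p (wBu y Ky).
  rewrite RintegralZl; last 2 first.
  - exact: measurable_segment0.
  - by apply: integrable_continuous_itv => y;
      apply: (@continuous_comp _ _ _ (fun y : R => `|y|) (fun y => y ^+ k));
      [exact: norm_continuous|exact: exprn_continuous].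
  rewrite Rintegral_abs_exp /c factS natrM !exprS le_eqVlt; apply/orP; left; apply/eqP.
  have k0 : k.+1%:R != 0 :> R by rewrite pnatr_eq0.
  have f0 : k`!%:R != 0 :> R by rewrite pnatr_eq0 -lt0n fact_gt0.
  by move: (k.+1%:R) (k`!%:R) k0 f0 => e1 e2 e10 e20; field; rewrite e10 e20.
apply: (fourier_inj hw (wBv t (segment0_right t)).1 (wBu t (segment0_right t)).1) => n.
apply/eqP; rewrite -subr_eq0; apply/eqP/ComplexField.Normc.eq0_normc/eqP.
rewrite eq_le normc_ge0 andbT.
have lim0 : (B + B) * (C ^+ k * `|t| ^+ k / k`!%:R) @[k --> \oo] --> (B + B) * 0.
  apply: cvgM; first exact: cvg_cst.
  have := @cvg_exp_coeff R (C * `|t|); rewrite /exp_coeff.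
  by under eq_fun do rewrite exprMn.
rewrite mulr0 in lim0.
rewrite -(cvg_lim _ lim0)//; apply: limr_ge; first exact: cvgP lim0.
apply: nearW => k; have := dbound k t (segment0_right t) [:: n] isT.
by rewrite big_seq1.
Qed.

End uniqueness.

Theorem theorem1p6 (R : realType) (d p : nat) (hd : (1 <= d)%N)
    (hp : (2 <= p)%N) (w : 'rV[R]_d) (hw : forall i, w ord0 i != 0)
    (s : R) (hs : 0 <= s) (u0 : d.-tuple R -> R[i])
    (hu0 : wiener_plus w s u0)
    (hsupp : forall n, fourier w u0 n != 0 -> forall i, 1 <= n ord0 i)
    (hsmall : (wnorm w s u0 <=
      ((p%:R - 1) / p%:R *
       ((\sum_(i < d) w ord0 i ^+ 2) * (p%:R - 1) / 2)
         `^ (p%:R - 1)^-1)%:E)%E) :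
  exists u : R -> d.-tuple R -> R[i],
    [/\ solution w s p setT u0 u,
        forall (J : set R) (v : R -> d.-tuple R -> R[i]),
          is_interval J -> J 0 -> solution w s p J u0 v ->
          forall t, J t -> torus_aeq w (v t) (u t),
        forall t, wiener_plus w s (u t),
        quasiperiodic w s u &
        forall t, (wnorm w s (u t) <=
          (((\sum_(i < d) w ord0 i ^+ 2) * (p%:R - 1) / 2)
             `^ (p%:R - 1)^-1)%:E)%E].
Proof.
have a0_small := (wnorm_leP _ _ _ _).1 hsmall.
pose F := wave p w (fourier w u0).
pose orbit t : 'rV[R]_d := \row_i (w ord0 i ^+ 2 * t).
have Fplus th : wiener_plus w s (F th) by exact: wave_plus.
have Fcont : wcontinuous w s setT F by exact: wave_continuous.
have Fw th := wave_wnorm hd hp hw hs a0_small th.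
(* Stated for every [J], since [duhamel_unique] compares two solutions on the interval where the
   other one lives. *)
have sol (J : set R) : solution w s p J u0 (fun t => F (orbit t)).
  split=> [t _|t _|t n _].
  - by have [] := Fplus (orbit t).
  - apply/cvg_ereal0P => [y|e e0]; first exact: wnorm_ge0.
    have /cvg_ereal0P h := Fcont (orbit t) I.
    have {h} := h (fun y => wnorm_ge0 _ _ _) e e0.
    have co : orbit y @[y --> t] --> orbit t.
      apply/cvg_mx_entourageP => A eA.
      have near_entry i j : \forall y \near nbhs t, (orbit t i j, orbit y i j) \in A.
        have : w ord0 j ^+ 2 * y @[y --> t] --> w ord0 j ^+ 2 * t by exact: mulrl_continuous.
        move=> /cvg_entourageP/(_ A eA) h.
        have {h} h : \forall y \near nbhs t, A (w ord0 j ^+ 2 * t, w ord0 j ^+ 2 * y) by [].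
        by apply: filterS h => y yA; rewrite !mxE; apply/mem_set.
      have h : \forall y \near nbhs t, forall i j, (orbit t i j, orbit y i j) \in A.
        by apply: filter_forall => i; apply: filter_forall => j; exact: near_entry.
      exact: h.
    move=> h; have {h} h : \forall y \near nbhs t, setT (orbit y) ->
        (wnorm w s (fun z => F (orbit y) z - F (orbit t) z)%R <= e%:E)%E by exact: co _ h.
    by apply: filterS h => y h _; exact: h.
  - exact: (wave_duhamel hd hp hw hs a0_small hsupp).
exists (fun t => F (orbit t)); split.
- exact: sol.
- by move=> J v iJ J0 solv t Jt; exact: duhamel_unique iJ J0 (sol J) solv t Jt.
- by move=> t; exact: Fplus.
- exists F; split => //.
  + by move=> m th; apply: aeW => x _; exact: wave_periodic.
  + by move=> t; apply: aeW.
- by move=> t; exact: Fw.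
Qed.
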